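(* For every integer $k\geq 1$ there exists a centrally symmetric map on the orientable surface of genus $g=2k-1$ with exactly $24+12\left\lfloor \frac{2k-1}{2}\right\rfloor$ vertices, all of whose faces are hexagons.
   Context: A surface is a connected, compact 2-manifold without boundary. A map $M$ on a surface $S$ is an embedding in $S$ of a finite simple graph $G$, all of whose vertices have degree $\geq 3$, such that the closures of the components of $S\setminus G$ (called the faces of $M$) are closed 2-cells, i.e. each is homeomorphic to a 2-disk. A map is polyhedral if the intersection of any two distinct faces is either empty, a common vertex, or a common edge. A polyhedral map $M$ is called centrally symmetric if it is invariant under an involution of its vertex set which fixes no face of $M$: the involution is an automorphism of $M$ of order two (mapping vertices, edges and 2-faces to vertices, edges and 2-faces) and no vertex, edge or 2-face is mapped to itself as a set. In particular the number of vertices is even, $2m$, and after labelling the vertices suitably the involution is $(1,2m)(2,2m-1)\cdots(m,m+1)$. *)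

(* Defs.v *)
From HB Require Import structures.
From mathcomp Require Import all_boot all_order all_algebra.
From mathcomp Require Import all_classical all_reals all_analysis.
Import Order.TTheory GRing.Theory Num.Theory numFieldNormedType.Exports.

Set Implicit Arguments.
Unset Strict Implicit.
Unset Printing Implicit Defensive.

Local Open Scope classical_set_scope.
Local Open Scope ring_scope.

(* The subspaces [A] of [T] and [B] of [U] are homeomorphic. The maps are total
   on the ambient types, but only their restrictions to [A] and [B] matter. *)
Definition homeomorphic (T U : topologicalType) (A : set T) (B : set U) : Prop :=
  exists (f : T -> U) (g : U -> T),
    [/\ {within A, continuous f} /\ {within B, continuous g},
        forall x, A x -> B (f x) /\ g (f x) = x &
        forall y, B y -> A (g y) /\ f (g y) = y].

Definition closed_disk (R : realType) : set (R * R) :=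
  [set p | p.1 ^+ 2 + p.2 ^+ 2 <= 1].
Arguments closed_disk R : clear implicits.

Definition surface (R : realType) (S : topologicalType) : Prop :=
  [/\ [set: S] !=set0,
      connected [set: S],
      compact [set: S],
      hausdorff_space S &
      forall x : S, exists (U : set S) (W : set (R * R)),
        [/\ open U, U x, open W & homeomorphic U W]].

(* A finite graph drawn in [S]: the edge [uv] is the path [path_of u v],
   parametrised by [0, 1]. Only the values of [path_of u v] at adjacent [u], [v]
   and at parameters in [0, 1] are meaningful. *)
Record drawing (R : realType) (S : topologicalType) := Drawing {
  vertex : finType;
  adj : rel vertex;
  pos : vertex -> S;
  path_of : vertex -> vertex -> R -> S
}.
Arguments adj {R S} d.
Arguments pos {R S} d.
Arguments path_of {R S} d.

Section Maps.
Variables (R : realType) (S : topologicalType) (M : drawing R S).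
Implicit Types (u v w : vertex M) (F : set S).

Definition edge u v : set S := path_of M u v @` `[0, 1].

Definition same_edge u v u' v' : Prop :=
  (u = u' /\ v = v') \/ (u = v' /\ v = u').

Definition skeleton : set S :=
  range (pos M) `|` [set x | exists u v, adj M u v /\ edge u v x].

Definition faces : set (set S) :=
  [set closure (connected_component (~` skeleton) x) | x in ~` skeleton].

Definition simple_graph : Prop := symmetric (adj M) /\ irreflexive (adj M).

(* Together these conditions say that the canonical map from the geometric
   realisation of the graph to [S] is well defined, continuous and injective;
   when [S] is Hausdorff it is then an embedding, by compactness. *)
Definition embedded : Prop :=
  injective (pos M) /\
  forall u v, adj M u v ->
    [/\ {within `[0, 1], continuous (path_of M u v)},
        {in `[0, 1] &, injective (path_of M u v)},
        path_of M u v 0 = pos M u /\ path_of M u v 1 = pos M v,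
        edge u v = edge v u /\
          (forall w, edge u v (pos M w) -> w = u \/ w = v) &
        forall u' v', adj M u' v' -> ~ same_edge u v u' v' ->
          edge u v `&` edge u' v' `<=` range (pos M)].

Definition surface_map : Prop :=
  [/\ simple_graph,
      embedded,
      forall u, (3 <= #|[pred v | adj M u v]|)%N &
      forall F, faces F -> homeomorphic F (closed_disk R)].

Definition polyhedral : Prop :=
  forall F F', faces F -> faces F' -> F <> F' ->
    [\/ F `&` F' = set0,
        exists v, F `&` F' = [set pos M v] |
        exists u v, adj M u v /\ F `&` F' = edge u v].

(* [c] lists the vertices of the face [F] in one of the cyclic orders in which
   they occur along its boundary. *)
Definition boundary_cycle F (c : seq (vertex M)) : Prop :=
  [/\ uniq c /\ (2 < size c)%N,
      cycle (adj M) c,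
      forall v, v \in c <-> F (pos M v) &
      forall u v, adj M u v ->
        (edge u v `<=` F <->
         (u \in c /\ next c u = v) \/ (v \in c /\ next c v = u))].

Definition hexagon F : Prop := exists c, boundary_cycle F c /\ size c = 6%N.

(* The boundaries of all faces can be directed so that no edge is traversed in
   the same direction by two distinct faces. *)
Definition coherently_orientable : Prop :=
  exists o : set S -> seq (vertex M),
    (forall F, faces F -> boundary_cycle F (o F)) /\
    (forall F F' u v, faces F -> faces F' -> F <> F' ->
       u \in o F -> u \in o F' -> next (o F) u = v -> next (o F') u <> v).

(* [adj] counts every edge twice, once in each direction. *)
Definition num_edges : nat := #|[pred e : vertex M * vertex M | adj M e.1 e.2]|./2.

Definition euler_characteristic (chi : int) : Prop :=
  exists f : nat, (faces #= `I_f)%card /\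
    chi = #|vertex M|%:Z - num_edges%:Z + f%:Z.

(* The permutation [s] of the vertices carries the boundary of [F] to that of
   [F']. *)
Definition maps_face (s : vertex M -> vertex M) F F' : Prop :=
  (forall v, F (pos M v) <-> F' (pos M (s v))) /\
  (forall u v, adj M u v -> (edge u v `<=` F <-> edge (s u) (s v) `<=` F')).

Definition automorphism (s : vertex M -> vertex M) : Prop :=
  [/\ bijective s,
      forall u v, adj M (s u) (s v) = adj M u v &
      forall F, faces F -> exists2 F', faces F' & maps_face s F F'].

Definition centrally_symmetric : Prop :=
  polyhedral /\
  exists s : vertex M -> vertex M,
    [/\ automorphism s /\ involutive s,
        forall v, s v <> v,
        forall u v, adj M u v -> ~ same_edge (s u) (s v) u v &
        forall F, faces F -> ~ maps_face s F F].

End Maps.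

(* Orientability and genus are read off from a cell decomposition of [S] by a
   map; every surface has one, and the outcome does not depend on its choice. *)
Definition orientable_surface_of_genus
    (R : realType) (S : topologicalType) (g : nat) : Prop :=
  surface R S /\
  exists M : drawing R S,
    [/\ surface_map M, coherently_orientable M &
        euler_characteristic M (2 - 2 * g%:Z)].

(* Main.v *)
Require Import Defs.
From mathcomp Require Import all_boot all_order all_algebra.
From mathcomp Require Import all_classical all_reals all_analysis.
From mathcomp Require Import ring lra zify.
Import Order.TTheory GRing.Theory Num.Theory numFieldNormedType.Exports.

Set Implicit Arguments.
Unset Strict Implicit.
Unset Printing Implicit Defensive.

(** The map is built for every genus [g >= 1], with [6 * (g + 3)] vertices and
    [4 * g + 8] hexagons; the theorem is the case [g = 2 * k - 1].

    Combinatorics. A tube may be attached to two disjoint hexagonal faces as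
    follows: the two faces are removed, the tube carries a new hexagonal cycle
    half-way, and the vertices of this cycle are joined alternately to every
    second vertex of one mouth and to every second vertex of the other. The two
    faces are replaced by six hexagons, so that 6 vertices, 12 edges and 4 faces
    are gained and the Euler characteristic drops by 2. Each new face has on its
    mouth three consecutive vertices of the removed hexagon, so the new faces
    meet the old ones no worse than that hexagon did, and the map stays
    polyhedral. Now take two spheres, each divided into two faces by a hexagon.
    Two tubes joining them give a torus with 24 vertices; each further tube is
    attached to two opposite faces of the previous one. After [g + 1] tubes the
    genus is [g]. Turning the cycle of every tube by half a turn and exchanging
    its two mouths, together with the two initial spheres, is the central
    symmetry; the removed faces were chosen opposite to each other so that it
    persists.

    Cutting the two initial hexagons into two further rings of six vertices
    makes this chain invariant under translation, except at its two ends. The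
    faces around a vertex are therefore a translate of the faces around a vertex
    of the chain of genus 1, 2 or 3 ([corner_model]), where every condition
    needed is checked by computation ([small_chains_ok]).

    Topology. The surface is the space of barycentric weights carried by the
    triangles obtained by coning each hexagon from a new point. Three or four
    hexagons meet at each vertex, so each link in this complex is a cycle of
    length 6 or 8. The star of a point whose link is such a cycle is carried to
    a convex polygon by sending the link to 6 or 8 rays of the plane; the inverse
    is given by piecewise linear hat functions ([hat_combine], [combine_hat]).
    These charts give all the topology ([polyhedron_surface]); moreover the
    edges fill exactly the part of the surface where all cone points have weight
    zero, so the faces of the drawing are the stars of the cone points
    ([facesE]) and every combinatorial property of the hexagons becomes a
    property of the drawing. *)

Local Open Scope classical_set_scope.
Local Open Scope ring_scope.

(** * Continuous functions *)

Lemma continuous_pair (S T U : topologicalType) (f : S -> T) (g : S -> U) :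
  continuous f -> continuous g -> continuous (fun x => (f x, g x)).
Proof. by move=> cf cg x; apply: cvg_pair; [exact: cf | exact: cg]. Qed.

Lemma continuous_fst (S T : topologicalType) : continuous (@fst S T).
Proof. by move=> x; exact: cvg_fst. Qed.

Lemma continuous_snd (S T : topologicalType) : continuous (@snd S T).
Proof. by move=> x; exact: cvg_snd. Qed.

Section RealContinuity.
Variables (R : realType) (T : topologicalType).
Implicit Types f g : T -> R.

Lemma continuous_cst (a : R) : continuous (fun _ : T => a).
Proof. by move=> x; exact: cvg_cst. Qed.

Lemma continuous_add f g :
  continuous f -> continuous g -> continuous (fun x => f x + g x).
Proof. by move=> cf cg x; apply: cvgD; [exact: cf | exact: cg]. Qed.

Lemma continuous_opp f : continuous f -> continuous (fun x => - f x).
Proof. by move=> cf x; apply: cvgN; exact: cf. Qed.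

Lemma continuous_mul f g :
  continuous f -> continuous g -> continuous (fun x => f x * g x).
Proof. by move=> cf cg x; apply: cvgM; [exact: cf | exact: cg]. Qed.

Lemma continuous_maxr f g :
  continuous f -> continuous g -> continuous (fun x => Num.max (f x) (g x)).
Proof.
by move=> cf cg x; apply: (@continuous_max R T f g); [exact: cf | exact: cg].
Qed.

Lemma continuous_minr f g :
  continuous f -> continuous g -> continuous (fun x => Num.min (f x) (g x)).
Proof.
by move=> cf cg x; apply: (@continuous_min R T f g); [exact: cf | exact: cg].
Qed.

Lemma continuous_sum (I : Type) (r : seq I) (P : pred I) (F : I -> T -> R) :
  (forall i, P i -> continuous (F i)) ->
  continuous (fun x => \sum_(i <- r | P i) F i x).
Proof. by apply: continuous_big; exact: add_continuous. Qed.

Lemma continuous_inv f :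
  (forall x, f x != 0) -> continuous f -> continuous (fun x => (f x)^-1).
Proof. by move=> f0 cf x; apply: cvgV; [exact: f0 | exact: cf]. Qed.

End RealContinuity.

(** * Radial maps between gauge balls *)
Section Gauges.
Variable R : realType.
Implicit Types (q : R * R) (N : R * R -> R).

Definition scale (t : R) q : R * R := (t * q.1, t * q.2).

(** The last condition makes the level sets bounded; it is what forces a radial
    map to be continuous at the origin. *)
Definition gauge N : Prop :=
  [/\ continuous N,
      forall t q, 0 <= t -> N (scale t q) = t * N q &
      forall q, `|q.1| <= N q /\ `|q.2| <= N q].

Lemma gauge_ge0 N q : gauge N -> 0 <= N q.
Proof. by case=> _ _ /(_ q) [+ _]; apply: le_trans; exact: normr_ge0. Qed.

Lemma gauge_eq0 N q : gauge N -> (N q == 0) = (q == (0, 0)).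
Proof.
move=> gN; apply/eqP/eqP => [Nq0|->].
  case: gN => _ _ /(_ q); rewrite Nq0 !normr_le0 => -[/eqP q1 /eqP q2].
  by case: q q1 q2 {Nq0} => ? ? /= -> ->.
have [_ /(_ 0 (0, 0) (lexx _)) + _] := gN.
by rewrite /scale !mul0r.
Qed.

(** This map moves each point along its ray, from its level for [N1] to the same
    level for [N2]. Exchanging [N1] and [N2] inverts it, hence any two gauge
    balls, such as a convex polygon and the round disk, are homeomorphic. *)
Definition radial_map N1 N2 q : R * R := scale (N1 q / N2 q) q.

Lemma radial_map_level N1 N2 q : gauge N1 -> gauge N2 ->
  N2 (radial_map N1 N2 q) = N1 q.
Proof.
move=> g1 g2; have [_ h2 _] := g2.
rewrite /radial_map h2; last by rewrite divr_ge0 ?gauge_ge0.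
have [/eqP|N2q] := eqVneq (N2 q) 0; last by rewrite divfK.
rewrite gauge_eq0 // => /eqP ->.
have /eqP -> : N1 (0, 0) == 0 by rewrite gauge_eq0.
by rewrite !mul0r.
Qed.

Lemma radial_mapK N1 N2 : gauge N1 -> gauge N2 ->
  cancel (radial_map N1 N2) (radial_map N2 N1).
Proof.
move=> g1 g2 q; have [-> | q0] := eqVneq q (0, 0).
  by rewrite /radial_map /scale /= !mulr0.
rewrite {1}/radial_map radial_map_level //.
have [_ h1 _] := g1.
have N1q : N1 q != 0 by rewrite gauge_eq0.
have N2q : N2 q != 0 by rewrite gauge_eq0.
rewrite {1}/radial_map h1; last by rewrite divr_ge0 ?gauge_ge0.
rewrite /radial_map /scale /= !mulrA.
have -> : N1 q / (N1 q / N2 q * N1 q) * N1 q / N2 q = 1.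
  by field; rewrite N1q N2q.
by rewrite !mul1r; case: q {q0 N1q N2q}.
Qed.

Lemma continuous_radial_map N1 N2 : gauge N1 -> gauge N2 ->
  continuous (radial_map N1 N2).
Proof.
move=> g1 g2 q; have [c1 _ _] := g1; have [c2 _ b2] := g2.
have [-> | q0] := eqVneq q (0, 0); last first.
  have cr : N1 x / N2 x @[x --> q] --> N1 q / N2 q.
    have N2q : N2 q != 0 by rewrite gauge_eq0.
    exact: (cvgM (c1 q) (cvgV N2q (c2 q))).
  exact: (cvg_pair (cvgM cr (@continuous_fst R R q))
                   (cvgM cr (@continuous_snd R R q))).
have r0 : radial_map N1 N2 (0, 0) = (0, 0) by rewrite /radial_map /scale /= !mulr0.
rewrite /continuous_at r0.
(* Near the origin the reshaped point is controlled by its level, which is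
   [N1 q]. *)
have N10 : N1 q @[q --> (0 : R, 0 : R)] --> (0 : R).
  have /eqP N0 : N1 (0, 0) == 0 by rewrite gauge_eq0.
  by have := c1 (0, 0); rewrite /continuous_at N0.
have sq (h : R * R -> R) : (forall q, `|h q| <= N1 q) ->
    h q @[q --> (0 : R, 0 : R)] --> (0 : R).
  move=> hN; apply: norm_cvg0; apply: (@squeeze_cvgr _ _ _ _ (cst 0) N1) => //.
    by near=> x; rewrite normr_ge0 hN.
  exact: cvg_cst.
have sq1 : (radial_map N1 N2 x).1 @[x --> (0 : R, 0 : R)] --> (0 : R).
  by apply: sq => x; rewrite -(radial_map_level x g1 g2);
    case: (b2 (radial_map N1 N2 x)).
have sq2 : (radial_map N1 N2 x).2 @[x --> (0 : R, 0 : R)] --> (0 : R).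
  by apply: sq => x; rewrite -(radial_map_level x g1 g2);
    case: (b2 (radial_map N1 N2 x)).
exact: (cvg_pair sq1 sq2).
Unshelve. all: by end_near.
Qed.

Definition euclidean_norm q : R := Num.sqrt (q.1 ^+ 2 + q.2 ^+ 2).

Lemma gauge_euclidean : gauge euclidean_norm.
Proof.
split=> [q|t q t0|q].
- have c1 := @continuous_fst R R; have c2 := @continuous_snd R R.
  apply: (@continuous_comp _ _ _ (fun q : R * R => q.1 ^+ 2 + q.2 ^+ 2)).
    by move: q; apply: continuous_add; exact: continuous_mul.
  exact: sqrt_continuous.
- rewrite /euclidean_norm /scale /= !exprMn -mulrDr.
  by rewrite sqrtrM ?exprn_ge0 // sqrtr_sqr ger0_norm.
- rewrite -!sqrtr_sqr; split; apply: ler_wsqrtr.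
    by rewrite lerDl sqr_ge0.
  by rewrite lerDr sqr_ge0.
Qed.

Lemma closed_diskE : closed_disk R = [set q | euclidean_norm q <= 1].
Proof.
apply/seteqP; split=> q; rewrite /closed_disk /= /euclidean_norm => h.
  by rewrite -[leRHS]sqrtr1 ler_wsqrtr.
by move: h; rewrite -[leRHS]sqrtr1 ler_psqrt ?nnegrE ?addr_ge0 ?sqr_ge0.
Qed.

End Gauges.

(** * Hat functions of a fan of six or eight rays *)
Section Fans.
Variable R : realType.
Implicit Types (n i j : nat) (s t : R) (a : nat -> R) (q : R * R).

(** Consecutive rays are bases of the integer lattice of determinant 1, so the
    coordinates of a point in the cone that they span are determinants. *)
Definition hexagonal_rays : seq (int * int) :=
  [:: (1, 0); (1, 1); (0, 1); (-1, 0); (-1, -1); (0, -1)].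

Definition octagonal_rays : seq (int * int) :=
  [:: (1, 0); (1, 1); (0, 1); (-1, 1); (-1, 0); (-1, -1); (0, -1); (1, -1)].

Definition intray n j : int * int :=
  nth (0, 0) (if n == 6%N then hexagonal_rays else octagonal_rays) j.

Definition ray n j : R * R := ((intray n j).1%:~R, (intray n j).2%:~R).

Definition det2 (K : pzRingType) (u v : K * K) : K := u.1 * v.2 - u.2 * v.1.

Definition combine n a : R * R :=
  (\sum_(j < n) a j * (ray n j).1, \sum_(j < n) a j * (ray n j).2).

(** On each of the two cones that contain the ray [j], the coordinate along this
    ray is one of the two determinants, and convexity of the polygon makes it the
    smaller one; off these cones one of the two is negative or zero. *)
Definition hat n j q : R :=
  Num.max 0 (Num.min (det2 (ray n ((j + n.-1) %% n)) q)
                     (det2 q (ray n (j.+1 %% n)))).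

Definition hat_sum n q : R := \sum_(j < n) hat n j q.

(** The cone indexed by [i] is spanned by the rays [i] and [i + 1 mod n]. *)
Definition in_cone n i a : Prop :=
  forall j, (j < n)%N -> j <> i -> j <> (i.+1 %% n)%N -> a j = 0.

Lemma hat_ge0 n j q : 0 <= hat n j q.
Proof. by rewrite /hat le_max lexx. Qed.

Lemma continuous_hat n j : continuous (hat n j).
Proof.
have c1 := @continuous_fst R R; have c2 := @continuous_snd R R.
apply: continuous_maxr; first exact: continuous_cst.
by apply: continuous_minr; apply: continuous_add; try apply: continuous_opp;
  apply: continuous_mul => //; exact: continuous_cst.
Qed.

Lemma continuous_hat_sum n : continuous (hat_sum n).
Proof. by apply: continuous_sum => j _; exact: continuous_hat. Qed.

Lemma hat_scale n j t q : 0 <= t -> hat n j (scale t q) = t * hat n j q.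
Proof.
move=> t0; rewrite /hat /det2 /scale /= maxr_pMr // minr_pMr // mulr0.
by congr (Num.max _ (Num.min _ _)); ring.
Qed.

Definition cone_point n i s t : R * R :=
  (s * (ray n i).1 + t * (ray n (i.+1 %% n)).1,
   s * (ray n i).2 + t * (ray n (i.+1 %% n)).2).

Lemma succ_mod_neq n i : (1 < n)%N -> (i < n)%N -> (i.+1 %% n != i)%N.
Proof.
move=> n1; rewrite leq_eqVlt => /predU1P[e|lt]; last by rewrite modn_small // gtn_eqF.
by rewrite e modnn; case: i e => // e; rewrite -e in n1.
Qed.

Lemma combine_cone n i a : (1 < n)%N -> (i < n)%N -> in_cone n i a ->
  combine n a = cone_point n i (a i) (a (i.+1 %% n)%N).
Proof.
move=> n1 lt_in ac.
have lt_i'n : (i.+1 %% n < n)%N by rewrite ltn_mod (ltn_trans _ n1).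
pose i0 := Ordinal lt_in; pose i1 := Ordinal lt_i'n.
have i1i0 : i1 != i0 by rewrite -val_eqE /= succ_mod_neq.
have sumE (c : nat -> R) : \sum_(j < n) a j * c j = a i * c i + a i1 * c i1.
  rewrite (bigD1 i0) //= (bigD1 i1) //= big1 ?addr0 // => j /andP[ji0 ji1].
  by rewrite ac ?mul0r //; apply/eqP.
by rewrite /combine (sumE (fun j => (ray n j).1)) (sumE (fun j => (ray n j).2)).
Qed.

(** The value of the [j]-th hat at the point of coordinates [s, t] in the [i]-th
    cone is [s * e + t * f]; both arguments of the minimum are linear in [s, t]
    there, so that comparing integer coefficients is enough. *)
Definition hat_coefficients_ok n i j : bool :=
  let i' := (i.+1 %% n)%N in
  let u := intray n ((j + n.-1) %% n) in let v := intray n (j.+1 %% n) in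
  let a := det2 u (intray n i) in let b := det2 u (intray n i') in
  let c := det2 (intray n i) v in let d := det2 (intray n i') v in
  let e : int := (j == i)%:Z in let f : int := (j == i')%:Z in
  [|| [&& a == e, b == f, e <= c & f <= d],
      [&& c == e, d == f, e <= a & f <= b],
      [&& e == 0, f == 0, a <= 0 & b <= 0] |
      [&& e == 0, f == 0, c <= 0 & d <= 0]].

Lemma hat_coefficients n i j : n = 6%N \/ n = 8%N ->
  (i < n)%N -> (j < n)%N -> hat_coefficients_ok n i j.
Proof.
have H : all (fun n => all (fun i => all (hat_coefficients_ok n i) (iota 0 n))
                           (iota 0 n)) [:: 6%N; 8%N] by vm_compute.
move=> n68 lt_in lt_jn; have nin : n \in [:: 6%N; 8%N].
  by case: n68 => ->.
by apply: (allP (allP (allP H n nin) i _)); rewrite mem_iota.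
Qed.

Lemma hat_cone_point n i j s t : n = 6%N \/ n = 8%N ->
    (i < n)%N -> (j < n)%N -> 0 <= s -> 0 <= t ->
  hat n j (cone_point n i s t) = s * (j == i)%:R + t * (j == i.+1 %% n)%N%:R.
Proof.
move=> n68 lt_in lt_jn s0 t0; have := hat_coefficients n68 lt_in lt_jn.
rewrite /hat_coefficients_ok; set i' := (i.+1 %% n)%N.
set u := intray n ((j + _) %% n); set v := intray n (j.+1 %% n).
have -> : hat n j (cone_point n i s t) =
    Num.max 0 (Num.min (s * (det2 u (intray n i))%:~R + t * (det2 u (intray n i'))%:~R)
                       (s * (det2 (intray n i) v)%:~R + t * (det2 (intray n i') v)%:~R)).
  rewrite /hat /det2 /cone_point /ray -/u -/v -/i' /= !rmorphB !rmorphM /=.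
  by congr (Num.max _ (Num.min _ _)); ring.
move: (det2 u _) (det2 u _) (det2 _ v) (det2 _ v) => a b c d.
have mono (x y : int) r : 0 <= r -> x <= y -> r * x%:~R <= r * y%:~R.
  by move=> r0 xy; rewrite ler_wpM2l // ler_int.
have pos (z w : bool) : 0 <= s * z%:R + t * w%:R.
  by rewrite addr_ge0 // mulr_ge0 ?ler0n.
case/or4P => /and4P[/eqP e1 /eqP e2 h1 h2].
- by rewrite e1 e2 min_l ?lerD ?mono //; apply: max_r; exact: pos.
- by rewrite e1 e2 min_r ?lerD ?mono //; apply: max_r; exact: pos.
- have {e1 e2} [-> ->] : (j == i) = false /\ (j == i') = false.
    by move: e1 e2; case: eqP; case: eqP.
  rewrite !mulr0 addr0; apply: max_l; rewrite ge_min; apply/orP; left.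
  by rewrite -[leRHS](addr0 0) lerD // mulr_ge0_le0 // lerz0.
- have {e1 e2} [-> ->] : (j == i) = false /\ (j == i') = false.
    by move: e1 e2; case: eqP; case: eqP.
  rewrite !mulr0 addr0; apply: max_l; rewrite ge_min; apply/orP; right.
  by rewrite -[leRHS](addr0 0) lerD // mulr_ge0_le0 // lerz0.
Qed.

(** Together with [combine_hat]: the hat functions invert the map that combines
    the rays with non-negative weights supported by a cone. *)
Lemma hat_combine n i a : n = 6%N \/ n = 8%N -> (i < n)%N ->
  (forall j, (j < n)%N -> 0 <= a j) -> in_cone n i a ->
  forall j, (j < n)%N -> hat n j (combine n a) = a j.
Proof.
move=> n68 lt_in a0 ac j lt_jn.
have n1 : (1 < n)%N by case: n68 => ->.
have lt_i'n : (i.+1 %% n < n)%N by rewrite ltn_mod (ltn_trans _ n1).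
rewrite (combine_cone n1 lt_in ac) hat_cone_point ?a0 //.
have [->|/eqP ji] := eqVneq j i.
  by rewrite eq_sym (negPf (succ_mod_neq n1 lt_in)) mulr1 mulr0 addr0.
have [->|/eqP ji'] := eqVneq j (i.+1 %% n)%N; first by rewrite mulr1 mulr0 add0r.
by rewrite !mulr0 addr0 ac.
Qed.

Lemma cones_cover n q : n = 6%N \/ n = 8%N ->
  exists i s t, [/\ (i < n)%N, 0 <= s, 0 <= t & q = cone_point n i s t].
Proof.
case: q => x y.
have E (u v u' v' : R) : u = u' -> v = v' -> (u, v) = (u', v') by move=> -> ->.
(* The cone containing [(x, y)] is read off from signs. *)
have H n' i s t : (i < n')%N -> 0 <= s -> 0 <= t -> (x, y) = cone_point n' i s t ->
  exists i s t, [/\ (i < n')%N, 0 <= s, 0 <= t & (x, y) = cone_point n' i s t].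
  by move=> *; exists i, s, t.
case=> ->.
- case: (leP 0 x) => x0; case: (leP 0 y) => y0; case: (leP x y) => xy.
  + by apply: (@H _ 1%N x (y - x)) => //; [lra | apply: E; rewrite /=; lra].
  + by apply: (@H _ 0%N (x - y) y) => //; [lra | apply: E; rewrite /=; lra].
  + lra.
  + by apply: (@H _ 5%N (- y) x) => //; [lra | apply: E; rewrite /=; lra].
  + by apply: (@H _ 2%N y (- x)) => //; [lra | apply: E; rewrite /=; lra].
  + lra.
  + by apply: (@H _ 3%N (y - x) (- y)) => //; [lra | lra | apply: E; rewrite /=; lra].
  + by apply: (@H _ 4%N (- x) (x - y)) => //; [lra | lra | apply: E; rewrite /=; lra].
- case: (leP 0 x) => x0; case: (leP 0 y) => y0; case: (leP x y) => xy;
    case: (leP 0 (x + y)) => xy'; try lra.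
  + by apply: (@H _ 1%N x (y - x)) => //; [lra | apply: E; rewrite /=; lra].
  + by apply: (@H _ 0%N (x - y) y) => //; [lra | apply: E; rewrite /=; lra].
  + by apply: (@H _ 7%N (- y) (x + y)) => //; [lra | apply: E; rewrite /=; lra].
  + by apply: (@H _ 6%N (- x - y) x) => //; [lra | apply: E; rewrite /=; lra].
  + by apply: (@H _ 2%N (x + y) (- x)) => //; [lra | apply: E; rewrite /=; lra].
  + by apply: (@H _ 3%N y (- x - y)) => //; [lra | apply: E; rewrite /=; lra].
  + by apply: (@H _ 4%N (y - x) (- y)) => //; [lra | lra | apply: E; rewrite /=; lra].
  + by apply: (@H _ 5%N (- x) (x - y)) => //; [lra | lra | apply: E; rewrite /=; lra].
Qed.

Lemma combine_hat n q : n = 6%N \/ n = 8%N ->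
  (exists2 i, (i < n)%N & in_cone n i (fun j => hat n j q)) /\
  combine n (fun j => hat n j q) = q.
Proof.
move=> n68; have n1 : (1 < n)%N by case: n68 => ->.
have [i [s [t [lt_in s0 t0 ->]]]] := cones_cover q n68.
have lt_i'n : (i.+1 %% n < n)%N by rewrite ltn_mod (ltn_trans _ n1).
have ic : in_cone n i (fun j => hat n j (cone_point n i s t)).
  by move=> j lt_jn /eqP/negPf ji /eqP/negPf ji'; rewrite hat_cone_point // ji ji' !mulr0 addr0.
split; first by exists i.
rewrite (combine_cone n1 lt_in ic) !hat_cone_point // !eqxx.
by rewrite eq_sym (negPf (succ_mod_neq n1 lt_in)) !mulr0 !mulr1 addr0 add0r.
Qed.

(** The sum of the hats is the gauge whose unit ball is the polygon with the ends
    of the rays as boundary points. *)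
Lemma gauge_hat_sum n : n = 6%N \/ n = 8%N -> gauge (hat_sum n).
Proof.
move=> n68; split=> [|t q t0|q].
- exact: continuous_hat_sum.
- by rewrite /hat_sum mulr_sumr; apply: eq_bigr => j _; rewrite hat_scale.
- have [_ {1 3}<-] := combine_hat q n68.
  have ray1 j : `|(ray n j).1| <= 1 /\ `|(ray n j).2| <= 1.
    by rewrite /ray /intray; case: n68 => ->;
      case: j => [|[|[|[|[|[|[|[|j]]]]]]]] /=; rewrite ?nth_nil /=
      ?rmorphN1 ?normrN ?normr1 ?normr0 ?lexx ?ler01.
  split; (apply: le_trans (ler_norm_sum _ _ _) _);
    apply: ler_sum => j _; rewrite normrM (ger0_norm (hat_ge0 _ _ _));
    by rewrite ler_piMr ?hat_ge0 //; case: (ray1 j).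
Qed.

End Fans.
Lemma next_nth_mod (X : eqType) (x0 : X) (y : seq X) i :
  uniq y -> (i < size y)%N -> next y (nth x0 y i) = nth x0 y (i.+1 %% size y).
Proof.
case: y => // a y u lt_iy; rewrite next_nth mem_nth // index_uniq //.
move: lt_iy; rewrite /= leq_eqVlt => /predU1P[[->]|lt_iy].
  by rewrite modnn nth_default.
by rewrite modn_small //= (set_nth_default a).
Qed.

(** * Two-dimensional polyhedra *)
Section Polyhedra.
Variables (R : realType) (X : finType) (T : {set {set X}}).
Implicit Type x : X.

Definition supported (w : X -> R) (t : {set X}) : Prop := forall x, x \notin t -> w x = 0.

Definition barycentric : set {ptws X -> R} :=
  [set p | [/\ forall x, 0 <= p x, \sum_x p x = 1 &
               exists2 t, t \in T & supported p t]].

(** The simplices of the geometric realisation are the sets of weights supported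
    by one member of [T]; the topology is that of pointwise convergence. *)
Definition polyhedron : topologicalType := set_type barycentric.

Definition bary x (p : polyhedron) : R := set_val p x.

Definition to_polyhedron (w : X -> R) (bw : barycentric w) : polyhedron :=
  exist _ (w : {ptws X -> R}) (mem_set bw).

Lemma coord_to_polyhedron (w : X -> R) (bw : barycentric w) x :
  bary x (to_polyhedron bw) = w x.
Proof. by []. Qed.

Lemma coordP (p : polyhedron) : barycentric (bary^~ p).
Proof. exact: set_mem (valP p). Qed.

Lemma coord_ge0 x (p : polyhedron) : 0 <= bary x p.
Proof. by case: (coordP p). Qed.

Lemma coord_inj (p q : polyhedron) : (forall x, bary x p = bary x q) -> p = q.
Proof. by move=> e; apply: val_inj; apply: funext. Qed.

Lemma continuous_coord x : continuous (bary x).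
Proof.
move=> p.
apply: (@continuous_comp polyhedron {ptws X -> R} R set_val (fun f => f x)).
  exact: initial_continuous.
exact: (@proj_continuous X (fun _ => R) x).
Qed.

(** A map into a polyhedron is continuous as soon as each weight is; all the
    maps below are built from this criterion. *)
Lemma continuous_polyhedron (Y : topologicalType) (h : Y -> polyhedron) :
  (forall x, continuous (fun y => bary x (h y))) -> continuous h.
Proof.
move=> ch.
apply: (@continuous_comp_initial _ Y _ (set_val : barycentric -> {ptws X -> R}) h).
move=> y; apply/cvg_sup => x.
exact: (@continuous_comp_initial _ Y _ (fun f : X -> R => f x) (set_val \o h)
  (ch x) y).
Qed.

Lemma polyhedron_hausdorff : hausdorff_space polyhedron.
Proof.
move=> p q pq; apply: coord_inj => x; apply: Rhausdorff => A B nA nB.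
have [r [Ar Br]] := pq _ _ (@continuous_coord x p A nA) (@continuous_coord x q B nB).
by exists (bary x r).
Qed.

Definition star x : set polyhedron :=
  [set p | exists t, [/\ t \in T, x \in t & supported (bary^~ p) t]].

Definition open_star x : set polyhedron := [set p | 0 < bary x p].

Lemma open_star_sub x : open_star x `<=` star x.
Proof.
move=> p px; have [_ _ [t tT st]] := coordP p; exists t; split=> //.
by apply/negPn/negP => /st px0; move: px; rewrite /open_star /= px0 ltxx.
Qed.

Lemma open_open_star x : open (open_star x).
Proof.
apply: (@open_comp _ _ (bary x) [set r | 0 < r]); last exact: open_gt.
by move=> p _; exact: continuous_coord.
Qed.

Lemma open_stars_cover (p : polyhedron) : exists x, open_star x p.
Proof.
apply: contrapT => /forallNP np; have [p0 + _] := coordP p.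
rewrite big1; first by move/eqP; rewrite eq_sym oner_eq0.
by move=> x _; apply/eqP; rewrite eq_le p0 andbT leNgt; apply/negP/np.
Qed.

Definition triangle x1 x2 x3 : {set X} := [set x1; x2; x3]%SET.

Lemma in_triangle x1 x2 x3 x :
  (x \in triangle x1 x2 x3) = [|| x == x1, x == x2 | x == x3].
Proof. by rewrite !inE orbA. Qed.

(** The link of [x] in [T] is required to be the single cycle [y]. *)
Definition link x (y : seq X) : Prop :=
  [/\ uniq (x :: y),
      forall a, a \in y -> triangle x a (next y a) \in T &
      forall t, t \in T -> x \in t -> exists2 a, a \in y & t = triangle x a (next y a)].


Section Chart.
Variables (x : X) (y : seq X).
Hypotheses (xy : link x y) (y68 : size y = 6%N \/ size y = 8%N).
Local Notation n := (size y).
Implicit Types (q : R * R) (p : polyhedron).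

Let y_uniq : uniq y. Proof. by case: xy => /andP[]. Qed.
Let x_notin_y : x \notin y. Proof. by case: xy => /andP[]. Qed.
Let n_gt1 : (1 < n)%N. Proof. by case: y68 => ->. Qed.

Let nth_in j : (j < n)%N -> nth x y j \in y. Proof. exact: mem_nth. Qed.
Let nth_neq j : (j < n)%N -> (nth x y j == x) = false.
Proof. by move=> /nth_in yj; apply: contraNF x_notin_y => /eqP <-. Qed.

Definition flatten_star (p : polyhedron) : R * R :=
  combine n (fun j => bary (nth x y j) p).

(** Outside the polygon of gauge at most 1 the hats are divided by their sum: this
    retracts the plane onto the polygon, so that [lift] is defined and continuous
    on the whole plane. *)
Definition lift_coord q z : R :=
  let N := Num.max 1 (hat_sum n q) in
  if z == x then 1 - hat_sum n q / N
  else if z \in y then hat n (index z y) q / N else 0.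

Let N_gt0 q : 0 < Num.max 1 (hat_sum n q).
Proof. by rewrite lt_max ltr01. Qed.

Lemma barycentric_lift q : barycentric (lift_coord q).
Proof.
have N0 := N_gt0 q; split.
- move=> z; rewrite /lift_coord; case: ifP => _.
    by rewrite subr_ge0 ler_pdivrMr // mul1r le_max lexx orbT.
  by case: ifP => _; rewrite // divr_ge0 ?hat_ge0 ?ltW.
- rewrite (bigD1 x) //= {1}/lift_coord eqxx.
  rewrite (eq_bigr (fun z => if z \in y then hat n (index z y) q /
      Num.max 1 (hat_sum n q) else 0)); last first.
    by move=> z /negPf zx; rewrite /lift_coord zx.
  rewrite -big_mkcondr /= (eq_bigl (mem y)); last first.
    move=> z /=; case: eqP => //= ->; exact/esym/negbTE.
  rewrite -big_uniq //= (big_nth x) big_mkord.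
  rewrite (eq_bigr (fun j : 'I_n => hat n j q / Num.max 1 (hat_sum n q))).
    by rewrite -mulr_suml subrK.
  by move=> j _; rewrite index_uniq.
- have [[i lt_in ic] _] := combine_hat q y68; have [_ yT _] := xy.
  exists (triangle x (nth x y i) (next y (nth x y i))); first exact/yT/nth_in.
  move=> z; rewrite in_triangle !negb_or next_nth_mod // => /and3P[zx zi zi'].
  rewrite /lift_coord (negPf zx); case: ifP => // zy.
  rewrite ic ?mul0r ?index_mem // => e.
    by rewrite -e nth_index ?eqxx in zi.
  by rewrite -e nth_index ?eqxx in zi'.
Qed.

Definition lift q : polyhedron := to_polyhedron (barycentric_lift q).

Lemma continuous_lift : continuous lift.
Proof.
have cS := @continuous_hat_sum R n.
have cN : continuous (fun q => (Num.max 1 (hat_sum n q))^-1).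
  apply: continuous_inv => [q|]; first by rewrite gt_eqF.
  by apply: continuous_maxr => //; exact: continuous_cst.
apply: continuous_polyhedron => z.
have [zx|zx] := eqVneq z x.
  have -> : (fun q => bary z (lift q)) =
      fun q => 1 + - (hat_sum n q * (Num.max 1 (hat_sum n q))^-1).
    by apply: funext => q; rewrite coord_to_polyhedron /lift_coord zx eqxx.
  apply: continuous_add; first exact: continuous_cst.
  by apply: continuous_opp; exact: continuous_mul.
have [zy|zy] := boolP (z \in y).
  have -> : (fun q => bary z (lift q)) =
      fun q => hat n (index z y) q * (Num.max 1 (hat_sum n q))^-1.
    by apply: funext => q; rewrite coord_to_polyhedron /lift_coord (negPf zx) zy.
  by apply: continuous_mul => //; exact: continuous_hat.
have -> : (fun q => bary z (lift q)) = fun=> 0.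
  by apply: funext => q; rewrite coord_to_polyhedron /lift_coord (negPf zx) (negPf zy).
exact: continuous_cst.
Qed.

Lemma continuous_flatten_star : continuous flatten_star.
Proof.
by apply: continuous_pair; apply: continuous_sum => j _;
  apply: continuous_mul; (exact: continuous_coord || exact: continuous_cst).
Qed.

Lemma star_lift q : star x (lift q).
Proof.
have [[i lt_in ic] _] := combine_hat q y68; have [_ yT _] := xy.
exists (triangle x (nth x y i) (next y (nth x y i))); split.
- exact/yT/nth_in.
- by rewrite in_triangle eqxx.
move=> z; rewrite in_triangle !negb_or next_nth_mod // => /and3P[zx zi zi'].
rewrite coord_to_polyhedron /lift_coord (negPf zx); case: ifP => // zy.
rewrite ic ?mul0r ?index_mem // => e.
  by rewrite -e nth_index ?eqxx in zi.
by rewrite -e nth_index ?eqxx in zi'.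
Qed.

Lemma coord_apex_lift q : hat_sum n q <= 1 -> bary x (lift q) = 1 - hat_sum n q.
Proof.
by move=> q1; rewrite coord_to_polyhedron /lift_coord eqxx max_l // divr1.
Qed.

Lemma coord_rim_lift q j : hat_sum n q <= 1 -> (j < n)%N ->
  bary (nth x y j) (lift q) = hat n j q.
Proof.
move=> q1 lt_jn; rewrite coord_to_polyhedron /lift_coord nth_neq // mem_nth //.
by rewrite max_l // divr1 index_uniq.
Qed.

Lemma flatten_starK q : hat_sum n q <= 1 -> flatten_star (lift q) = q.
Proof.
move=> q1; have [_ {2}<-] := combine_hat q y68.
by rewrite /flatten_star /combine; congr (_, _); apply: eq_bigr => j _;
  rewrite coord_rim_lift.
Qed.

(** The weights of a point of the star, read along the link, live on two
    consecutive places, as required to invert [combine] by the hats. *)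
Lemma star_cone p : star x p ->
  (exists2 i, (i < n)%N & in_cone n i (fun j => bary (nth x y j) p)) /\
  (forall z, z != x -> z \notin y -> bary z p = 0).
Proof.
case=> t [tT xt st]; have [_ _ /(_ t tT xt)[a ay te]] := xy.
have lt_an : (index a y < n)%N by rewrite index_mem.
have nxt : nth x y ((index a y).+1 %% n) = next y a.
  by rewrite -next_nth_mod // nth_index.
split; last first.
  move=> z zx zy; apply: st; rewrite te in_triangle !negb_or zx /=.
  by apply/andP; split; apply: contraNneq zy => ->; rewrite ?mem_next.
exists (index a y) => // j lt_jn ja ja'; apply: st.
rewrite te in_triangle !negb_or nth_neq //=; apply/andP; split; apply/eqP => e.
  by apply: ja; rewrite -e index_uniq.
apply: ja'; rewrite -(index_uniq x lt_jn y_uniq) e -nxt index_uniq //.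
by rewrite ltn_mod (ltn_trans _ n_gt1).
Qed.

(** The gauge of the flattened point is the weight that the apex does not have:
    the open star is the inside of the polygon. *)
Lemma hat_sum_flatten_star p : star x p -> hat_sum n (flatten_star p) = 1 - bary x p.
Proof.
move=> sp; have [[i lt_in ic] z0] := star_cone sp.
have [p0 p1 _] := coordP p.
rewrite -p1 (bigD1 x) //= [X in X - _]addrC addrK /hat_sum.
rewrite (bigID (mem y)) /= [X in _ + X]big1 ?addr0; last first.
  by move=> z /andP[zx zy]; exact: z0.
rewrite (eq_bigl (mem y)); last first.
  by move=> z /=; case: eqP => //= ->; exact/esym/negbTE.
rewrite -big_uniq //= (big_nth x) big_mkord.
by apply: eq_bigr => j _; rewrite (hat_combine y68 lt_in).
Qed.

Lemma hat_sum_flatten_star_le1 p : star x p -> hat_sum n (flatten_star p) <= 1.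
Proof.
by move=> /hat_sum_flatten_star ->; rewrite gerBl coord_ge0.
Qed.

Lemma liftK p : star x p -> lift (flatten_star p) = p.
Proof.
move=> sp; have le1 := hat_sum_flatten_star_le1 sp.
have [[i lt_in ic] z0] := star_cone sp.
apply: coord_inj => z; have [->|zx] := eqVneq z x.
  by rewrite coord_apex_lift // hat_sum_flatten_star // opprB addrC subrK.
have [zy|zy] := boolP (z \in y); last first.
  by rewrite z0 // coord_to_polyhedron /lift_coord (negPf zx) (negPf zy).
rewrite -[in LHS](nth_index x zy) coord_rim_lift ?index_mem //.
rewrite (hat_combine y68 lt_in) ?index_mem ?nth_index //.
by move=> j _; exact: coord_ge0.
Qed.

Lemma star_closed_disk : homeomorphic (star x) (closed_disk R).
Proof.
have gS := @gauge_hat_sum R n y68; have gE := @gauge_euclidean R.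
rewrite closed_diskE.
exists (radial_map (hat_sum n) (@euclidean_norm R) \o flatten_star),
  (lift \o radial_map (@euclidean_norm R) (hat_sum n)); split.
- split; apply: continuous_subspaceT => z; apply: continuous_comp.
  + exact: continuous_flatten_star.
  + exact: continuous_radial_map.
  + exact: continuous_radial_map.
  + exact: continuous_lift.
- move=> p sp /=; rewrite radial_map_level // radial_mapK // liftK //; split=> //.
  exact: hat_sum_flatten_star_le1.
- move=> q q1 /=; rewrite flatten_starK ?radial_mapK ?radial_map_level //.
  by split=> //; exact: star_lift.
Qed.

Lemma open_star_homeomorphic : homeomorphic (open_star x) [set q : R * R | hat_sum n q < 1].
Proof.
exists flatten_star, lift; split.
- by split; apply: continuous_subspaceT;
    [exact: continuous_flatten_star | exact: continuous_lift].
- move=> p px; have sp := open_star_sub px; split; last exact: liftK.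
  by rewrite /= hat_sum_flatten_star // gtrBl.
- move=> q q1; split; last by apply: flatten_starK; exact: ltW.
  by rewrite /open_star /= coord_apex_lift ?subr_gt0 // ltW.
Qed.

Lemma open_hat_ball : open [set q : R * R | hat_sum n q < 1].
Proof.
apply: (@open_comp _ _ (hat_sum n) [set r | r < 1]); last exact: open_lt.
by move=> q _; exact: continuous_hat_sum.
Qed.

Let scale0 (t : R) : scale t (0, 0) = (0, 0) :> R * R.
Proof. by rewrite /scale /= !mulr0. Qed.

Let scale1 q : scale 1 q = q.
Proof. by rewrite /scale !mul1r; case: q. Qed.

(** The open star is a union of segments issued from the apex. *)
Lemma open_star_connected : connected (open_star x).
Proof.
have [_ hS _] := @gauge_hat_sum R n y68.
have S0 : hat_sum n (0, 0) = 0 :> R by rewrite -(scale0 0) hS // mul0r.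
pose segment p := (fun t => lift (scale t (flatten_star p))) @` `[0, 1].
have -> : open_star x = \bigcup_(p in open_star x) segment p.
  apply/seteqP; split=> p.
    move=> px; exists p => //; exists 1; first by rewrite /= in_itv /= ler01 lexx.
    by rewrite scale1 liftK //; exact: open_star_sub.
  case=> r rx [t /=]; rewrite in_itv /= => /andP[t0 t1] <-.
  have lt1 : hat_sum n (flatten_star r) < 1.
    by rewrite (hat_sum_flatten_star (open_star_sub rx)) gtrBl.
  have ltt : hat_sum n (scale t (flatten_star r)) < 1.
    rewrite hS //; apply: le_lt_trans lt1; rewrite ler_piMl //.
    exact/gauge_ge0/gauge_hat_sum.
  by rewrite /open_star /= coord_apex_lift ?subr_gt0 // ltW.
apply: bigcup_connected.
  exists (lift (0, 0)) => p px; exists 0; first by rewrite /= in_itv /= lexx ler01.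
  by rewrite /scale !mul0r.
move=> p px; apply: connected_continuous_connected; first exact: segment_connected.
apply: continuous_subspaceT => t; apply: continuous_comp; last exact: continuous_lift.
move: t; apply: continuous_pair; apply: continuous_mul;
  by [move=> t; exact: cvg_id | exact: continuous_cst].
Qed.

(** As [lift] retracts the plane onto the polygon, a square containing the polygon
    is also mapped onto the star; compactness follows. *)
Lemma star_image : star x = lift @` [set q : R * R | `|q.1| <= 1 /\ `|q.2| <= 1].
Proof.
apply/seteqP; split=> [p sp|p [q _ <-]]; last exact: star_lift.
exists (flatten_star p); last exact: liftK.
have [_ _ /(_ (flatten_star p))[q1 q2]] := @gauge_hat_sum R n y68.
have le1 := hat_sum_flatten_star_le1 sp.
by split; [exact: le_trans q1 le1 | exact: le_trans q2 le1].
Qed.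

Lemma star_compact : compact (star x).
Proof.
rewrite star_image; apply: continuous_compact.
  by apply: continuous_subspaceT; exact: continuous_lift.
have -> : [set q : R * R | `|q.1| <= 1 /\ `|q.2| <= 1] =
    `[-1, 1]%classic `*` `[-1, 1]%classic.
  by apply/seteqP; split=> q /=; rewrite !in_itv /= !ler_norml.
by apply: compact_setX; exact: segment_compact.
Qed.

(** A point of the star is the limit of the points of its segment to the apex. *)
Lemma closure_open_star : closure (open_star x) = star x.
Proof.
have [_ hS _] := @gauge_hat_sum R n y68.
apply/seteqP; split.
  have : closed (star x) by apply: compact_closed polyhedron_hausdorff star_compact.
  by move=> /closure_id ->; apply: closureS; exact: open_star_sub.
move=> p sp; pose h t := lift (scale t (flatten_star p)).
have ch : continuous h.
  move=> t; apply: continuous_comp; last exact: continuous_lift.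
  move: t; apply: continuous_pair; apply: continuous_mul;
    by [move=> t; exact: cvg_id | exact: continuous_cst].
have <- : h 1 = p by rewrite /h scale1 liftK.
apply: (@closed_cvg _ _ (at_left (1 : R)) _ h); last first.
- by apply: cvg_at_left_filter; exact: ch.
- near=> t; apply: subset_closure.
  have t0 : 0 <= t by near: t; exact: nbhs_left_ge.
  have t1 : t < 1 by near: t; exact: nbhs_left_lt.
  have lt1 : hat_sum n (scale t (flatten_star p)) < 1.
    rewrite hS //; apply: le_lt_trans t1; rewrite ler_piMr //.
    exact: hat_sum_flatten_star_le1.
  by rewrite /open_star /= coord_apex_lift ?subr_gt0 // ltW.
- exact: closed_closure.
Unshelve. all: by end_near.
Qed.

Lemma star_connected : connected (star x).
Proof. rewrite -closure_open_star; exact/connected_closure/open_star_connected. Qed.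

Lemma apex_in_open_star : exists p : polyhedron, bary x p = 1.
Proof.
have [_ hS _] := @gauge_hat_sum R n y68.
have S0 : hat_sum n (0, 0) = 0 :> R by rewrite -(scale0 0) hS // mul0r.
by exists (lift (0, 0)); rewrite coord_apex_lift S0 ?subr0 ?ler01.
Qed.

End Chart.

Definition coface_rel : rel X :=
  [rel x1 x2 | [exists t in T, (x1 \in t) && (x2 \in t)]].

Section ClosedSurface.
Hypotheses (Xlink : forall x, exists y,
              link x y /\ (size y = 6%N \/ size y = 8%N))
           (X0 : X)
           (Xconnected : forall x, connect coface_rel X0 x).

Let apex_ex x : exists p : polyhedron, bary x p = 1.
Proof. have [y [xy y68]] := Xlink x; exact: apex_in_open_star xy y68. Qed.

Let star_conn x : connected (star x).
Proof. have [y [xy y68]] := Xlink x; exact: star_connected xy y68. Qed.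

Lemma stars_meet x1 x2 : coface_rel x1 x2 -> star x1 `&` star x2 !=set0.
Proof.
case/existsP => t /and3P[tT x1t x2t].
have bw : barycentric (fun z => (z == x1)%:R).
  split=> [z|| ]; first exact: ler0n.
    by rewrite (bigD1 x1) //= eqxx big1 ?addr0 // => z /negPf ->.
  by exists t => // z zt; case: eqP => // zx; rewrite zx x1t in zt.
by exists (to_polyhedron bw); split; exists t; split=> // z zt;
  rewrite coord_to_polyhedron; case: eqP => // zx; rewrite zx x1t in zt.
Qed.

Lemma polyhedron_connected : connected [set: polyhedron].
Proof.
have [p0 p0x] := apex_ex X0.
have sp0 : star X0 p0 by apply: open_star_sub; rewrite /open_star /= p0x ltr01.
suff sub x : star x `<=` connected_component [set: polyhedron] p0.
  suff <- : connected_component [set: polyhedron] p0 = [set: polyhedron].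
    exact: component_connected.
  apply/seteqP; split=> // p _.
  by have [x /open_star_sub/sub] := open_stars_cover p.
have [s + ->] := connectP (Xconnected x).
elim/last_ind: s => [_|s z IH] /=; first exact: connected_component_max.
rewrite rcons_path last_rcons => /andP[/IH{}IH /stars_meet[q [q1 q2]]].
move=> r zr; apply: (@connected_component_trans _ _ q); first exact: IH.
by apply: (connected_component_max q2).
Qed.

Lemma polyhedron_compact : compact [set: polyhedron].
Proof.
have -> : [set: polyhedron] = \big[setU/set0]_(x : X) star x.
  apply/seteqP; split=> // p _.
  have [x /open_star_sub px] := open_stars_cover p.
  rewrite (bigD1 x) //=; by left.
apply: bigsetU_compact => x _.
have [y [xy y68]] := Xlink x; exact: star_compact xy y68.
Qed.

(** The open stars of the vertices cover the polyhedron and serve as charts;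
    the stars, finite in number, give compactness, and they give connectedness
    because the stars of two vertices of a common simplex meet. *)
Theorem polyhedron_surface : surface R polyhedron.
Proof.
split.
- by have [p _] := apex_ex X0; exists p.
- exact: polyhedron_connected.
- exact: polyhedron_compact.
- exact: polyhedron_hausdorff.
- move=> p; have [x px] := open_stars_cover p; have [y [xy y68]] := Xlink x.
  exists (open_star x), [set q : R * R | hat_sum (size y) q < 1]; split=> //.
  + exact: open_open_star.
  + exact: open_hat_ball.
  + exact: open_star_homeomorphic.
Qed.

End ClosedSurface.
End Polyhedra.
Arguments bary {R X T} x p.
(** * Schemes of hexagonal maps *)
Lemma next_neq (X : eqType) (s : seq X) x :
  uniq s -> (1 < size s)%N -> x \in s -> next s x != x.
Proof.
move=> us s1 xs; have lt_i : (index x s < size s)%N by rewrite index_mem.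
rewrite -{1 2}(nth_index x xs) next_nth_mod // nth_uniq ?succ_mod_neq //.
by rewrite ltn_mod (ltn_trans _ s1).
Qed.

Section Interleave.
Variables (A B : eqType).
Implicit Type l : seq (A * B).

(** When [l] lists the neighbours of a vertex alternating with the faces between
    them, this is the link of the vertex once the faces have been coned. *)
Definition interleave l : seq (A + B) :=
  flatten [seq [:: inl e.1; inr e.2] | e <- l].

Lemma size_interleave l : size (interleave l) = (size l).*2.
Proof. by elim: l => // e l IH; rewrite /= IH. Qed.

Lemma inl_interleave l a : (inl a \in interleave l) = (a \in map fst l).
Proof. by elim: l => // e l IH; rewrite /= !inE IH. Qed.

Lemma inr_interleave l b : (inr b \in interleave l) = (b \in map snd l).
Proof. by elim: l => // e l IH; rewrite /= !inE IH. Qed.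

Lemma uniq_interleave l :
  uniq (map fst l) -> uniq (map snd l) -> uniq (interleave l).
Proof.
elim: l => // e l IH /= /andP[e1 /IH{}IH] /andP[e2 /IH ->].
by rewrite !inE inl_interleave inr_interleave e1 e2.
Qed.

Lemma nth_interleave l z e0 i : (i < size l)%N ->
  nth z (interleave l) i.*2 = inl (nth e0 l i).1 /\
  nth z (interleave l) i.*2.+1 = inr (nth e0 l i).2.
Proof. by elim: l i => // e l IH [|i] //= /IH. Qed.

Lemma next_interleave l e : uniq (map fst l) -> uniq (map snd l) -> e \in l ->
  next (interleave l) (inl e.1) = inr e.2 /\
  next (interleave l) (inr e.2) = inl (next l e).1.
Proof.
move=> u1 u2 el; have ul := uniq_interleave u1 u2; have l_uniq := map_uniq u1.
have lt_il : (index e l < size l)%N by rewrite index_mem.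
have [] := @nth_interleave l (inl e.1) e _ lt_il; rewrite nth_index // => n1 n2.
split.
  rewrite -[in LHS]n1 next_nth_mod // size_interleave; last lia.
  by rewrite modn_small; [exact: n2 | lia].
rewrite -[in LHS]n2 next_nth_mod // size_interleave; last lia.
have -> : ((index e l).*2.+2 %% (size l).*2 = ((index e l).+1 %% size l).*2)%N.
  by rewrite -doubleS -!mul2n muln_modr.
have [|-> _] := @nth_interleave l (inl e.1) e ((index e l).+1 %% size l).
  by rewrite ltn_mod; lia.
by rewrite -[in RHS](nth_index e el) next_nth_mod.
Qed.

End Interleave.

Section HexagonalMaps.
Variables (V Fc : finType) (bd : Fc -> seq V).
Implicit Types (u v : V) (f g : Fc).

(** [l] lists the edges [v -> e.1] and faces [e.2] around [v] in cyclic order: the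
    boundary of the face [e.2] leaves [v] along [e] and enters it along the next
    edge. This forces the faces to be coherently oriented. *)
Definition vertex_fan v (l : seq (V * Fc)) : Prop :=
  [/\ uniq (map fst l), uniq (map snd l),
      forall f, v \in bd f -> (next (bd f) v, f) \in l &
      forall e, e \in l ->
        [/\ v \in bd e.2, next (bd e.2) v = e.1 & prev (bd e.2) v = (next l e).1]].

Definition share_face : rel V :=
  [rel u v | [exists f, (u \in bd f) && (v \in bd f)]].

(** The combinatorial data from which a polyhedral map with hexagonal faces can be
    realised on an oriented surface. The two conditions [hex_meet_size] and
    [hex_meet_edge] say that the map is polyhedral. *)
Record hexagonal_scheme : Prop := HexagonalScheme {
  hex_uniq : forall f, uniq (bd f);
  hex_size : forall f, size (bd f) = 6%N;
  hex_fan : forall v, exists l,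
    vertex_fan v l /\ (size l = 3%N \/ size l = 4%N);
  hex_meet_size : forall f g, f != g ->
    (size [seq v <- bd f | v \in bd g] <= 2)%N;
  hex_meet_edge : forall f g u v, f != g -> u != v ->
    u \in bd f -> v \in bd f -> u \in bd g -> v \in bd g ->
    next (bd f) u = v \/ next (bd f) v = u;
  hex_connected : exists v0, forall v, connect share_face v0 v }.

Hypothesis H : hexagonal_scheme.

Definition dart u v : bool := [exists f, (u \in bd f) && (next (bd f) u == v)].

Lemma dartP u v : reflect (exists2 f, u \in bd f & next (bd f) u = v) (dart u v).
Proof.
by apply: (iffP existsP) => -[f]; [move=> /andP[uf /eqP e]; exists f|
  move=> uf e; exists f; rewrite uf e /=].
Qed.

Lemma dart_next f u : u \in bd f -> dart u (next (bd f) u).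
Proof. by move=> uf; apply/dartP; exists f. Qed.

Lemma next_bd_neq f u : u \in bd f -> next (bd f) u != u.
Proof. by apply: next_neq; rewrite ?hex_uniq ?hex_size. Qed.

(** An oriented edge of the boundary of a face is traversed backwards by the next
    face around its end. *)
Lemma dart_sym : symmetric dart.
Proof.
suff sub u v : dart u v -> dart v u by move=> u v; apply/idP/idP; exact: sub.
case/dartP => f uf <-; set w := next _ _.
have wf : w \in bd f by rewrite mem_next.
have [l [[_ _ l1 l2] _]] := hex_fan H w.
have el := l1 f wf; have [_ _] := l2 _ el.
rewrite /= prev_next ?hex_uniq // => ->.
set e := next l _; have [|we <- _] := l2 e; first by rewrite mem_next.
exact: dart_next.
Qed.

Lemma dart_irr : irreflexive dart.
Proof.
by move=> u; apply/dartP => -[f uf]; apply/eqP; exact: next_bd_neq.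
Qed.

(** The neighbours listed around a vertex are distinct, so an oriented edge
    belongs to one face only: this is coherent orientation. *)
Lemma dart_face_inj f g u : u \in bd f -> u \in bd g ->
  next (bd f) u = next (bd g) u -> f = g.
Proof.
move=> uf ug e; have [l [[u1 _ l1 _] _]] := hex_fan H u.
have := l1 g ug; rewrite -e => gl; have fl := l1 f uf.
pose d := (u, f).
have i1 := index_mem (next (bd f) u, f) l; have i2 := index_mem (next (bd f) u, g) l.
rewrite fl in i1; rewrite gl in i2.
have : index (next (bd f) u, f) l = index (next (bd f) u, g) l.
  apply/eqP; rewrite -(nth_uniq u _ _ u1) ?size_map //.
  by rewrite !(nth_map d) // !nth_index.
by move=> ei; have := nth_index d fl; rewrite ei nth_index // => -[].
Qed.

Lemma dart_degree u : (3 <= #|[pred v | dart u v]|)%N.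
Proof.
have [l [[u1 _ _ l2] l34]] := hex_fan H u.
have l3 : (3 <= size (map fst l))%N by rewrite size_map; case: l34 => ->.
apply: leq_trans l3 _; rewrite -(card_uniqP u1); apply: subset_leq_card.
apply/fintype.subsetP => v /mapP[e el ->]; rewrite inE.
by have [ue <- _] := l2 e el; exact: dart_next.
Qed.

(** Each oriented edge lies on exactly one face, and each face has six. *)
Lemma card_darts : #|[pred e : V * V | dart e.1 e.2]| = (6 * #|Fc|)%N.
Proof.
pose D := [pred fv : Fc * V | fv.2 \in bd fv.1].
pose h (fv : Fc * V) := (fv.2, next (bd fv.1) fv.2).
have -> : #|[pred e : V * V | dart e.1 e.2]| = #|[seq h fv | fv in D]|.
  apply: eq_card => -[u v]; rewrite inE /=; apply/dartP/fintype.imageP.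
    by move=> [f uf <-]; exists (f, u).
  by move=> [[f w] /= wf [-> ->]]; exists f.
rewrite card_in_image; last first.
  move=> [f u] [g v]; rewrite /h !inE /= => uf vg [e1 e2].
  by rewrite -e1 in vg e2 *; rewrite (dart_face_inj uf vg e2).
rewrite -sum1_card (eq_bigl (fun fv : Fc * V => true && (fv.2 \in bd fv.1))) //.
rewrite -(pair_big_dep xpredT (fun f v => v \in bd f) (fun _ _ => 1%N)) /=.
rewrite (eq_bigr (fun=> 6%N)); last first.
  by move=> f _; rewrite sum1_card (card_uniqP (hex_uniq H f)) hex_size.
by rewrite sum_nat_const mulnC.
Qed.

(** * Realisation of a scheme *)
Definition cone_triangle f v : {set V + Fc} :=
  triangle (inr f) (inl v) (inl (next (bd f) v)).

Definition cone_complex : {set {set V + Fc}} :=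
  [set t | [exists f, exists v, (v \in bd f) && (t == cone_triangle f v)]]%SET.

Lemma cone_complexP t :
  reflect (exists f, exists2 v, v \in bd f & t = cone_triangle f v) (t \in cone_complex).
Proof.
rewrite inE; apply: (iffP existsP) => -[f].
  by case/existsP => v /andP[vf /eqP ->]; exists f, v.
by move=> [v vf ->]; exists f; apply/existsP; exists v; rewrite vf /=.
Qed.

Lemma cone_triangle_in f v : v \in bd f -> cone_triangle f v \in cone_complex.
Proof. by move=> vf; apply/cone_complexP; exists f, v. Qed.

Lemma in_cone_triangle_face f g v : (inr f \in cone_triangle g v) = (f == g).
Proof. by rewrite in_triangle /= orbF. Qed.

Lemma in_cone_triangle_vertex f u v :
  (inl u \in cone_triangle f v) = (u == v) || (u == next (bd f) v).
Proof. by rewrite in_triangle. Qed.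

Lemma link_face f : link cone_complex (inr f) (map inl (bd f)).
Proof.
have inl_inj : injective (@inl V Fc) by move=> ? ? [].
split.
- rewrite /= map_inj_uniq // hex_uniq // andbT.
  by apply/mapP => -[].
- move=> _ /mapP[v vf ->]; rewrite next_map ?hex_uniq //; exact: (cone_triangle_in vf).
- move=> t /cone_complexP[g [v vg ->]]; rewrite in_cone_triangle_face => /eqP fg.
  by rewrite -fg in vg *; exists (inl v); rewrite ?map_f // next_map ?hex_uniq.
Qed.

Lemma link_vertex v l : vertex_fan v l -> link cone_complex (inl v) (interleave l).
Proof.
case=> u1 u2 l1 l2.
have rot (x1 x2 x3 : V + Fc) : triangle x1 x2 x3 = triangle x2 x3 x1.
  by apply/setP => x; rewrite !in_triangle orbC orbA orbC.
have tri1 f : v \in bd f -> cone_triangle f v =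
    triangle (inl v) (inl (next (bd f) v)) (inr f).
  by move=> vf; rewrite /cone_triangle rot.
have tri2 f : v \in bd f -> cone_triangle f (prev (bd f) v) =
    triangle (inl v) (inr f) (inl (prev (bd f) v)).
  by move=> vf; rewrite /cone_triangle next_prev ?hex_uniq // -rot.
split.
- rewrite /= uniq_interleave // andbT inl_interleave.
  apply/negP => /mapP[e el ve]; have [vf + _] := l2 e el.
  by rewrite -ve; apply/eqP; exact: next_bd_neq.
- move=> [w|f].
    rewrite inl_interleave => /mapP[e el ->]; have [vf nx _] := l2 e el.
    rewrite (next_interleave u1 u2 el).1 -nx -tri1 //; exact: cone_triangle_in.
  rewrite inr_interleave => /mapP[e el ->]; have [vf _ pv] := l2 e el.
  rewrite (next_interleave u1 u2 el).2 -pv -tri2 //.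
  by apply: cone_triangle_in; rewrite mem_prev.
- move=> t /cone_complexP[f [w wf ->]]; rewrite in_cone_triangle_vertex.
  case/predU1P => [vw|/eqP vw].
    rewrite -vw in wf *; have el := l1 f wf.
    exists (inl (next (bd f) v)); first by rewrite inl_interleave (map_f fst el).
    by rewrite tri1 // (next_interleave u1 u2 el).1.
  have vf : v \in bd f by rewrite vw mem_next.
  have wv : w = prev (bd f) v by rewrite vw prev_next ?hex_uniq.
  have el := l1 f vf; have [_ _ pv] := l2 _ el.
  exists (inr f); first by rewrite inr_interleave (map_f snd el).
  by rewrite wv tri2 // (next_interleave u1 u2 el).2 -pv.
Qed.

Lemma cone_complex_link x :
  exists y, link cone_complex x y /\ (size y = 6%N \/ size y = 8%N).
Proof.
case: x => [v|f]; last first.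
  by exists (map inl (bd f)); rewrite size_map hex_size //; split; [exact: link_face|left].
have [l [vl l34]] := hex_fan H v; exists (interleave l).
by rewrite size_interleave; split; [exact: link_vertex | case: l34 => ->; [left|right]].
Qed.

Lemma cone_complex_connected : exists x0, forall x, connect (coface_rel cone_complex) x0 x.
Proof.
have coface f v : v \in bd f -> connect (coface_rel cone_complex) (inl v) (inr f) /\
    connect (coface_rel cone_complex) (inr f) (inl v).
  move=> vf; have tT := cone_triangle_in vf.
  by split; apply: connect1; apply/existsP; exists (cone_triangle f v);
    rewrite tT in_cone_triangle_face in_cone_triangle_vertex !eqxx.
have [v0 cv0] := hex_connected H; exists (inl v0).
have cv v : connect (coface_rel cone_complex) (inl v0) (inl v).
  have [s + ->] := connectP (cv0 v).
  elim/last_ind: s => [|s w IH] //=; rewrite rcons_path last_rcons => /andP[/IH{}IH].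
  case/existsP => f /andP[uf wf].
  exact: connect_trans (connect_trans IH (coface _ _ uf).1) (coface _ _ wf).2.
case=> // f; have: (0 < size (bd f))%N by rewrite hex_size.
case: (bd f) (fun v => @coface f v) => //= v s cvs _.
by apply: connect_trans (cv v) (cvs v _).1; rewrite mem_head.
Qed.

Section Realization.
Variable R : realType.
Local Notation S := (polyhedron R cone_complex).
Implicit Types (p q : S) (t : R).

Lemma cone_polyhedron_surface : surface R S.
Proof.
have [x0 cx0] := cone_complex_connected.
exact: (polyhedron_surface R cone_complex_link cx0).
Qed.

(** Projecting the parameter to [0, 1] lets the edge paths be defined, and
    continuous, on the whole line. *)
Definition clamp t : R := Num.max 0 (Num.min 1 t).

Lemma clamp_itv t : 0 <= clamp t <= 1.
Proof. by rewrite /clamp le_max lexx ge_max ler01 ge_min lexx. Qed.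

Lemma clamp_id t : 0 <= t <= 1 -> clamp t = t.
Proof. by case/andP=> t0 t1; rewrite /clamp min_r // max_r. Qed.

Lemma continuous_clamp : continuous clamp.
Proof.
apply: continuous_maxr; first exact: continuous_cst.
by apply: continuous_minr; [exact: continuous_cst | move=> t; exact: cvg_id].
Qed.

Definition segment u v t (x : V + Fc) : R :=
  (1 - clamp t) * (x == inl u)%:R + clamp t * (x == inl v)%:R.

Lemma barycentric_segment u v t : u = v \/ dart u v ->
  barycentric cone_complex (segment u v t).
Proof.
move=> uv; have /andP[c0 c1] := clamp_itv t; split.
- by move=> x; rewrite addr_ge0 // mulr_ge0 ?ler0n // subr_ge0.
- have sum1 w : \sum_(x : V + Fc) (x == inl w)%:R = 1 :> R.
    by rewrite (bigD1 (inl w)) //= eqxx big1 ?addr0 // => x /negPf ->.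
  by rewrite big_split /= -!mulr_sumr !sum1 !mulr1 subrK.
have [f [w wf [uw vw]]] : exists f, exists2 w, w \in bd f &
    inl u \in cone_triangle f w /\ inl v \in cone_triangle f w.
  case: uv => [<-|/dartP[f uf <-]]; last first.
    by exists f, u; rewrite // !in_cone_triangle_vertex !eqxx orbT.
  have [l [[_ _ _ l2] l34]] := hex_fan H u.
  case: l l34 l2 => [[]//|e l _ /(_ e (mem_head _ _))[ue _ _]].
  by exists e.2, u; rewrite // !in_cone_triangle_vertex eqxx.
exists (cone_triangle f w) => [|x xt]; first exact: cone_triangle_in.
rewrite /segment; case: eqP => [xu|_]; first by rewrite xu uw in xt.
by case: eqP => [xv|_]; [rewrite xv vw in xt | rewrite !mulr0 addr0].
Qed.

Definition vertex_point v : S :=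
  to_polyhedron (barycentric_segment 0 (or_introl (erefl v))).

Definition edge_path u v t : S :=
  match pselect (dart u v) with
  | left uv => to_polyhedron (barycentric_segment t (or_intror uv))
  | right _ => vertex_point u
  end.

Lemma coord_vertex_point v x : bary x (vertex_point v) = (x == inl v)%:R.
Proof. by rewrite coord_to_polyhedron /segment -mulrDl subrK mul1r. Qed.

Lemma coord_edge_path u v t x : dart u v -> bary x (edge_path u v t) = segment u v t x.
Proof. by rewrite /edge_path; case: pselect. Qed.

Definition hex_drawing : drawing R S :=
  @Drawing R S V dart vertex_point edge_path.
Local Notation M := hex_drawing.

Definition vertex_support p (s : seq V) : Prop :=
  forall x, bary x p != 0 -> exists2 v, v \in s & x = inl v.

Lemma edgeE u v : dart u v -> edge (M := M) u v = [set p | vertex_support p [:: u; v]].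
Proof.
move=> uv; have /negPf nuv : u != v by apply/eqP => e; rewrite e dart_irr in uv.
apply/seteqP; split=> p.
  case=> t _ <- x; rewrite /= coord_edge_path // /segment.
  have [->|xu] := eqVneq x (inl u); first by exists u; rewrite ?mem_head.
  have [->|xv] := eqVneq x (inl v); first by exists v; rewrite ?inE ?eqxx ?orbT.
  by rewrite !mulr0 addr0 eqxx.
move=> sp; have z0 x : x != inl u -> x != inl v -> bary x p = 0.
  move=> xu xv; apply: contraTeq isT => /sp[w]; rewrite !inE.
  by case/orP => /eqP -> xw; rewrite xw eqxx in xu xv.
have [p0 p1 _] := coordP p; exists (bary (inl v) p).
  rewrite /= in_itv /= p0 /= -p1 (bigD1 (inl v)) //= lerDl sumr_ge0 //.
apply: coord_inj => x; rewrite /= coord_edge_path // /segment clamp_id; last first.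
  by rewrite p0 -p1 (bigD1 (inl v)) //= lerDl sumr_ge0.
have -> : 1 - bary (inl v) p = bary (inl u) p.
  rewrite -p1 (bigD1 (inl v)) //= (bigD1 (inl u)) /=; last first.
    by apply/eqP => -[/eqP]; rewrite nuv.
  rewrite big1 ?addr0; last by move=> y /andP[]; move=> ? ?; exact: z0.
  by rewrite addrC addrK.
have [->|xu] := eqVneq x (inl u).
  have -> : (inl u == inl v :> V + Fc) = false by apply/eqP => -[/eqP]; rewrite nuv.
  by rewrite mulr1 mulr0 addr0.
have [->|xv] := eqVneq x (inl v); first by rewrite mulr0 add0r mulr1.
by rewrite !mulr0 addr0 z0.
Qed.

Lemma skeletonE : skeleton M = [set p | forall f, bary (inr f) p = 0].
Proof.
apply/seteqP; split=> p.
  case=> [[v _ <-] f|[u [v [uv]]]]; first by rewrite /= coord_vertex_point.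
  rewrite edgeE // => sp f; apply: contraTeq isT => /sp[]//.
move=> p0; have [_ _ [t /cone_complexP[f [v vf ->]] st]] := coordP p; right.
exists v, (next (bd f) v); split; first exact: dart_next.
rewrite edgeE; last exact: dart_next.
move=> [w|g] px; last by rewrite p0 eqxx in px.
exists w => //; apply: contraNT px; rewrite !inE => nw; apply/eqP/st.
by rewrite in_cone_triangle_vertex.
Qed.

Local Notation face f := (star (R := R) (T := cone_complex) (inr f)).
Local Notation open_face f := (open_star (R := R) (T := cone_complex) (inr f)).

Lemma face_support f p : face f p <->
  exists2 v, v \in bd f & supported (bary^~ p) (cone_triangle f v).
Proof.
split=> [[t [/cone_complexP[g [v vg ->]] + st]]|[v vf st]].
  by rewrite in_cone_triangle_face => /eqP fg; rewrite -fg in vg st; exists v.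
exists (cone_triangle f v); split=> //; first exact: cone_triangle_in.
by rewrite in_cone_triangle_face.
Qed.

Lemma face_center_unique f g p : face f p -> f != g -> bary (inr g) p = 0.
Proof.
move=> /face_support[v vf st] fg; apply: st.
by rewrite in_cone_triangle_face eq_sym.
Qed.

Let link_faceP f : link cone_complex (inr f) (map inl (bd f)) /\
  (size (map (@inl V Fc) (bd f)) = 6%N \/ size (map (@inl V Fc) (bd f)) = 8%N).
Proof. by rewrite size_map hex_size //; split; [exact: link_face | left]. Qed.

(** A connected set avoiding the skeleton stays in one open star: there exactly
    one cone point has positive weight, so the condition that the weight of [f]
    is positive is both open and closed. *)
Lemma face_component f p : open_face f p ->
  connected_component (~` skeleton M) p = open_face f.
Proof.
move=> pf; have [lf l6] := link_faceP f.
have sub : open_face f `<=` ~` skeleton M.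
  by move=> q qf; rewrite skeletonE => /(_ f) q0; move: qf; rewrite /open_star /= q0 ltxx.
apply/seteqP; split; last first.
  apply: connected_component_max => //; exact: (open_star_connected lf l6).
set C := connected_component _ _.
have Cs : C `<=` ~` skeleton M by exact: connected_component_sub.
have Cc : connected C by exact: component_connected.
have Cp : C p by apply: connected_component_refl; exact: sub.
suff <- : C `&` open_face f = C by move=> q [].
apply: Cc; first by exists p.
  by exists (open_face f); first exact: open_open_star.
exists (\bigcap_(g in [set g | g != f]) [set q | bary (inr g) q <= 0]).
  apply: closed_bigI => g _.
  apply: (@preimage_closed _ _ (bary (inr g)) [set r | r <= 0]); last exact: closed_le.
  by move=> q _; exact: continuous_coord.
apply/seteqP; split=> q [Cq].
  move=> qf; split=> // g gf /=; rewrite (face_center_unique (f := f)) //.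
    exact: open_star_sub.
  by rewrite eq_sym.
move=> q0; split=> //; have := Cs q Cq; rewrite skeletonE /open_star /=.
apply: contra_notT; rewrite -leNgt => qf g.
apply/eqP; rewrite eq_le coord_ge0 andbT.
by have [->|gf] := eqVneq g f; [| exact: q0].
Qed.

Lemma facesE F : faces M F <-> exists f, F = face f.
Proof.
split=> [[p sk <-]|[f ->]].
  have /existsNP[f /eqP pf0] : ~ forall f, bary (inr f) p = 0.
    by move: sk; rewrite skeletonE.
  exists f.
  have [lf l6] := link_faceP f.
  have pf : open_face f p by rewrite /open_star /= lt0r pf0 coord_ge0.
  by rewrite (face_component pf) (closure_open_star R lf l6).
have [lf l6] := link_faceP f; have [p p1] := apex_in_open_star R lf l6.
have pf : open_face f p by rewrite /open_star /= p1 ltr01.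
exists p; last by rewrite (face_component pf) (closure_open_star R lf l6).
by rewrite /= skeletonE => /(_ f) /eqP; rewrite p1 oner_eq0.
Qed.

Lemma face_inj f g : face f = face g -> f = g.
Proof.
move=> e; have [lf l6] := link_faceP f; have [p p1] := apex_in_open_star R lf l6.
have: face f p by apply: open_star_sub; rewrite /open_star /= p1 ltr01.
rewrite e => /face_center_unique h; apply: contraTeq isT => fg.
have := h f; rewrite eq_sym fg p1 => /(_ isT)/eqP.
by rewrite oner_eq0.
Qed.

Lemma vertex_in_face f v : face f (vertex_point v) <-> v \in bd f.
Proof.
rewrite face_support; split=> [[w wf st]|vf].
  have : inl v \in cone_triangle f w.
    apply: contraTT isT => /st/eqP; rewrite coord_vertex_point eqxx.
    by rewrite oner_eq0.
  by rewrite in_cone_triangle_vertex => /orP[]/eqP ->; rewrite ?mem_next.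
exists v => // x xt; rewrite coord_vertex_point; case: eqP => // xv.
by rewrite xv in_cone_triangle_vertex eqxx in xt.
Qed.

Definition consecutive f u v : Prop :=
  (u \in bd f /\ next (bd f) u = v) \/ (v \in bd f /\ next (bd f) v = u).

(** The middle of an edge has positive weight at both ends, so the edge lies in a
    face only if a single triangle of this face contains both ends. *)
Lemma edge_in_face f u v : dart u v ->
  edge (M := M) u v `<=` face f <-> consecutive f u v.
Proof.
move=> uv; have /negPf nuv : u != v by apply/eqP => e; rewrite e dart_irr in uv.
rewrite edgeE //; split=> [sub|].
  have mid x : bary x (edge_path u v 2^-1) =
      2^-1 * (x == inl u)%:R + 2^-1 * (x == inl v)%:R :> R.
    by rewrite coord_edge_path // /segment clamp_id; [congr (_ * _ + _); lra | lra].
  have /sub/face_support[w wf st] : vertex_support (edge_path u v 2^-1) [:: u; v].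
    move=> x; rewrite mid.
    have [->|xu] := eqVneq x (inl u); first by exists u; rewrite ?mem_head.
    have [->|xv] := eqVneq x (inl v); first by exists v; rewrite ?inE ?eqxx ?orbT.
    by rewrite !mulr0 addr0 eqxx.
  have ut : inl u \in cone_triangle f w.
    apply: contraTT isT => /st; rewrite mid eqxx.
    by case: (_ == _) => /=; lra.
  have vt : inl v \in cone_triangle f w.
    apply: contraTT isT => /st; rewrite mid eqxx.
    by case: (_ == _) => /=; lra.
  move: ut vt nuv; rewrite !in_cone_triangle_vertex /consecutive.
  by case/orP => /eqP ->; case/orP => /eqP ->; rewrite ?eqxx //; [left|right].
have main w w' : w \in bd f -> next (bd f) w = w' ->
    [set p | vertex_support p [:: w; w']] `<=` face f.
  move=> wf e p sp; apply/face_support; exists w => // x xt.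
  apply: contraTeq isT => /sp[z]; rewrite !inE => zw xz; rewrite xz in xt.
  by rewrite in_cone_triangle_vertex e zw in xt.
case=> -[] => [|vf e p sp]; first exact: main.
by apply: (main v u) => // x /sp[z zs xz]; exists z => //;
  move: zs; rewrite !inE orbC.
Qed.

Lemma hex_simple : simple_graph M.
Proof. by split; [exact: dart_sym | exact: dart_irr]. Qed.

Lemma vertex_support1 p v : vertex_support p [:: v] -> p = vertex_point v.
Proof.
move=> sp; apply: coord_inj => x; rewrite coord_vertex_point.
have z0 y : y != inl v -> bary y p = 0.
  move=> yv; apply: contraTeq isT => /sp[w]; rewrite inE => /eqP -> yw.
  by rewrite yw eqxx in yv.
have [->|xv] := eqVneq x (inl v); last by rewrite z0.
have [_ + _] := coordP p; rewrite (bigD1 (inl v)) //= big1 ?addr0 //.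
Qed.

Lemma vertex_support_point v s : vertex_support (vertex_point v) s <-> v \in s.
Proof.
split=> [|vs x].
  move=> /(_ (inl v)); rewrite coord_vertex_point eqxx => /(_ (oner_neq0 _)).
  by case=> w ws [->].
by rewrite coord_vertex_point; have [->|_] := eqVneq x; [exists v | rewrite eqxx].
Qed.

Lemma hex_embedded : embedded M.
Proof.
split=> [u v e|u v uv].
  have := coord_vertex_point u (inl u); rewrite [vertex_point u]e coord_vertex_point eqxx.
  by case: eqP => [[]//|_ /eqP]; rewrite eq_sym oner_eq0.
have {}uv : dart u v := uv; have vu : dart v u by rewrite dart_sym.
have /negPf nuv : u != v by apply/eqP => e; rewrite e dart_irr in uv.
have clamp01 : clamp 0 = 0 /\ clamp 1 = 1.
  by split; apply: clamp_id; rewrite ?lexx ler01.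
split.
- apply: continuous_subspaceT; apply: continuous_polyhedron => x.
  have -> : (fun t => bary x (edge_path u v t)) =
      fun t => (1 + - clamp t) * (x == inl u)%:R + clamp t * (x == inl v)%:R.
    by apply: funext => t; rewrite coord_edge_path.
  have cc := @continuous_cst R R; have ccl := continuous_clamp.
  apply: continuous_add; apply: continuous_mul => //.
  by apply: continuous_add => //; exact: continuous_opp.
- move=> s t; rewrite !in_itv /= => s01 t01 e.
  have : bary (inl v) (edge_path u v s) = bary (inl v) (edge_path u v t).
    by rewrite [edge_path u v s]e.
  rewrite !coord_edge_path // /segment !clamp_id // eqxx.
  have -> : (inl v == inl u :> V + Fc) = false by rewrite eq_sym; apply/eqP => -[/eqP]; rewrite nuv.
  by rewrite !mulr0 !add0r !mulr1.
- split; apply: coord_inj => x; rewrite /= coord_edge_path // /segment coord_vertex_point.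
    by rewrite clamp01.1 subr0 mul1r mul0r addr0.
  by rewrite clamp01.2 subrr mul0r mul1r add0r.
- rewrite !edgeE //; split.
    by apply/seteqP; split=> p sp x /sp[z zs xz]; exists z => //;
      move: zs; rewrite !inE orbC.
  by move=> w /vertex_support_point; rewrite !inE => /orP[]/eqP; [left|right].
- move=> u' v' u'v' ne; have {}u'v' : dart u' v' := u'v'; rewrite !edgeE // => p [sp sp'].
  have [x px] : exists x, bary x p != 0.
    have [x] := open_stars_cover p; rewrite /open_star /= => px.
    by exists x; rewrite gt_eqF.
  (* The two edges have at most one end in common, and all the weight sits
     there. *)
  have [w ws xw] := sp x px; have [w' ws' xw'] := sp' x px.
  have {w' xw'} ws' : w \in [:: u'; v'] by move: xw'; rewrite xw => -[->].
  exists w => //; apply/esym/vertex_support1 => y py.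
  have [z zs yz] := sp y py; have [z' zs' yz'] := sp' y py.
  have {z' yz'} zs' : z \in [:: u'; v'] by move: yz'; rewrite yz => -[->].
  exists z => //; rewrite inE; apply/eqP; apply: contrapT => zw; apply: ne.
  move: ws zs ws' zs'; rewrite !inE /same_edge.
  by do 4![case/orP => /eqP ?]; try congruence; [left|right|right|left];
    split; congruence.
Qed.

Lemma hex_boundary_cycle f : boundary_cycle (M := M) (face f) (bd f).
Proof.
split.
- by rewrite hex_uniq // hex_size.
- by apply: cycle_from_next; [exact: hex_uniq | exact: dart_next].
- by move=> v; split=> /vertex_in_face.
- by move=> u v uv; exact: edge_in_face.
Qed.

Lemma hex_hexagon F : faces M F -> hexagon M F.
Proof.
case/facesE => f ->; exists (bd f); split; first exact: hex_boundary_cycle.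
by rewrite hex_size.
Qed.

Lemma hex_surface_map : surface_map M.
Proof.
split; [exact: hex_simple | exact: hex_embedded | exact: dart_degree |].
move=> F /facesE[f ->]; have [lf l6] := link_faceP f.
exact: star_closed_disk lf l6.
Qed.

Lemma hex_coherently_orientable : coherently_orientable M.
Proof.
pose o (F : set S) : seq V :=
  if [pick f | `[< F = face f >]] is Some f then bd f else [::].
have oE f : o (face f) = bd f.
  rewrite /o; case: pickP => [g /asboolP/face_inj -> //|/(_ f)].
  by rewrite asboolT.
exists o; split=> [F /facesE[f ->]|F F' u v /facesE[f ->] /facesE[g ->] ne].
  rewrite oE; exact: hex_boundary_cycle.
rewrite !oE => uf ug e e'; apply: ne.
by rewrite (dart_face_inj uf ug) // e e'.
Qed.

(** There are three times as many edges as faces. *)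
Lemma hex_euler_characteristic :
  euler_characteristic M (#|V|%:Z - 2 * #|Fc|%:Z).
Proof.
exists #|Fc|; split.
  have -> : faces M = (fun i : 'I_#|Fc| => face (enum_val i)) @` [set: 'I_#|Fc|].
    apply/seteqP; split=> [F /facesE[f ->]|F [i _ <-]].
      by exists (enum_rank f); rewrite ?enum_rankK.
    by apply/facesE; exists (enum_val i).
  apply: card_eq_trans (card_esym card_II); apply: inj_card_eq.
  by move=> i j _ _ /face_inj/enum_val_inj.
have -> : num_edges M = (3 * #|Fc|)%N by rewrite /num_edges card_darts; lia.
by rewrite /= PoszM; ring.
Qed.

(** A point common to two faces has no weight at the cone points, hence it is
    supported by the vertices that the two hexagons share. *)
Lemma hex_polyhedral : polyhedral M.
Proof.
move=> F F' /facesE[f ->] /facesE[g ->] ne.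
have fg : f != g by apply: contra_notN ne => /eqP ->.
have common p : face f p -> face g p ->
    vertex_support p [seq v <- bd f | v \in bd g].
  move=> pf pg [v|h] px; last first.
    exfalso; move/eqP: px; apply; have [hf|hf] := eqVneq f h; last first.
      exact: face_center_unique pf hf.
    by apply: face_center_unique pg _; rewrite -hf eq_sym.
  exists v => //; rewrite mem_filter; apply/andP; split.
    have /face_support[w wg st] := pg; have : inl v \in cone_triangle g w.
      by apply: contraNT px => /st ->.
    by rewrite in_cone_triangle_vertex => /orP[]/eqP ->; rewrite ?mem_next.
  have /face_support[w wg st] := pf; have : inl v \in cone_triangle f w.
    by apply: contraNT px => /st ->.
  by rewrite in_cone_triangle_vertex => /orP[]/eqP ->; rewrite ?mem_next.
have in2 v : v \in [seq v <- bd f | v \in bd g] <-> v \in bd f /\ v \in bd g.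
  by rewrite mem_filter; split=> [/andP[]|[-> ->]].
have us : uniq [seq v <- bd f | v \in bd g] by rewrite filter_uniq ?hex_uniq.
have := hex_meet_size H fg.
case es : [seq v <- bd f | v \in bd g] us in2 => [|u [|v [|//]]] us in2 _.
- apply: Or31; rewrite -subset0 => p [pf pg].
  have [x px] := open_stars_cover p; have := common p pf pg x; rewrite es.
  by rewrite gt_eqF // => /(_ isT)[].
- apply: Or32; exists u; apply/seteqP; split=> [p [pf pg]|p ->].
    by apply: vertex_support1; rewrite -es; exact: common.
  have [uf ug] : u \in bd f /\ u \in bd g by apply/in2; rewrite mem_head.
  by split; apply/vertex_in_face.
- have [uf ug] : u \in bd f /\ u \in bd g by apply/in2; rewrite mem_head.
  have [vf vg] : v \in bd f /\ v \in bd g by apply/in2; rewrite !inE eqxx orbT.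
  have uv : u != v by move: us; rewrite /= inE andbT.
  have cons h : h \in [:: f; g] -> consecutive h u v.
    rewrite !inE => /orP[]/eqP ->; rewrite /consecutive.
      by have [e|e] := hex_meet_edge H fg uv uf vf ug vg; [left | right].
    rewrite eq_sym in fg.
    by have [e|e] := hex_meet_edge H fg uv ug vg uf vf; [left | right].
  have duv : dart u v.
    have [[_ <-]|[_ <-]] := cons f (mem_head _ _); first exact: dart_next.
    by rewrite dart_sym; exact: dart_next.
  apply: Or33; exists u, v; split=> //; apply/seteqP; split=> [p [pf pg]|].
    by rewrite edgeE // -es; exact: common.
  by rewrite subsetI; split; apply/edge_in_face => //; apply: cons;
    rewrite !inE eqxx ?orbT.
Qed.

Section Symmetry.
Variables (s : V -> V) (fs : Fc -> Fc).

(** The symmetry of the chains below reverses orientation: it carries the boundary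
    of [f] to that of [fs f] run backwards. The last three conditions exclude
    fixed vertices, edges and faces. *)
Definition reversing_symmetry : Prop :=
  [/\ involutive s,
      forall f v, v \in bd f ->
        s v \in bd (fs f) /\ next (bd (fs f)) (s (next (bd f) v)) = s v,
      forall v, s v != v,
      forall f v, v \in bd f -> next (bd f) v != s v &
      forall f, exists2 v, v \in bd f & s v \notin bd f].

Lemma hex_centrally_symmetric : reversing_symmetry -> centrally_symmetric M.
Proof.
case=> sK s_bd s_neq s_edge s_face; split; first exact: hex_polyhedral.
have s_inj : injective s := inv_inj sK.
have s_in f v : (s v \in bd (fs f)) = (v \in bd f).
  apply/idP/idP => [|/s_bd[]//]; move=> svf.
  have sub : {subset map s (bd f) <= bd (fs f)} by move=> _ /mapP[w wf ->]; case: (s_bd f w wf).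
  have us : uniq (map s (bd f)) by rewrite map_inj_uniq // hex_uniq.
  have [] := uniq_min_size us sub; first by rewrite size_map !hex_size.
  by move=> _ /(_ (s v)); rewrite svf (mem_map s_inj).
have s_next f u v : u \in bd f ->
    next (bd (fs f)) (s u) = s v <-> v \in bd f /\ next (bd f) v = u.
  move=> uf; have := s_bd f (prev (bd f) u); rewrite mem_prev => /(_ uf)[_].
  rewrite next_prev ?hex_uniq // => ->; split=> [/s_inj <-|[vf <-]].
    by rewrite mem_prev next_prev ?hex_uniq.
  by rewrite prev_next ?hex_uniq.
have s_cons f u v : consecutive (fs f) (s u) (s v) <-> consecutive f u v.
  rewrite /consecutive !s_in; split.
    by move=> [[uf /(s_next _ _ _ uf)]|[vf /(s_next _ _ _ vf)]]; [right | left].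
  move=> [[uf e]|[vf e]]; [right | left].
    have vf : v \in bd f by rewrite -e mem_next.
    by split=> //; apply/s_next.
  have uf : u \in bd f by rewrite -e mem_next.
  by split=> //; apply/s_next.
have s_dart u v : dart u v -> dart (s u) (s v).
  case/dartP => f uf <-; have [su <-] := s_bd f u uf.
  by rewrite dart_sym; apply: dart_next; rewrite s_in mem_next.
have s_dartE u v : dart (s u) (s v) = dart u v.
  by apply/idP/idP => [/s_dart|/s_dart//]; rewrite !sK.
exists s; split.
- split=> //; split; [by exists s | exact: s_dartE |].
  move=> F /facesE[f ->]; exists (face (fs f)); first by apply/facesE; exists (fs f).
  split=> [v|u v uv].
    by rewrite !vertex_in_face s_in.
  by rewrite !edge_in_face ?s_dartE // s_cons.
- by move=> v; apply/eqP.
- move=> u v uv [[/eqP su _]|[su sv]]; first by rewrite (negPf (s_neq u)) in su.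
  case/dartP: uv => f uf e; have /eqP := s_edge f u uf; apply.
  by rewrite su.
- move=> F /facesE[f ->] [sv _]; have [v vf /negP] := s_face f; apply.
  by have /sv/vertex_in_face := (vertex_in_face f v).2 vf.
Qed.

End Symmetry.
End Realization.
End HexagonalMaps.
(** * The chain of tubes *)
Section HexagonalChains.
Local Open Scope nat_scope.

(** The vertex [i] of the ring [j]. The ring 0 is the cycle of the first tube and
    the rings 3, ..., [g + 2] are those of the other [g] tubes. The rings 1 and 2
    hold the two initial hexagons: one hexagon consists of the vertices 2, 3, 4
    of both rings, and the other one of the vertices 5, 0, 1. With this cut the
    rings 1 and 2 lie in the chain as cycles of tubes would, apart from the
    missing edges between the vertices 1 and 2 and between the vertices 4 and 5
    of each. *)
Definition site (j i : nat) : nat := 6 * j + i.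

Definition sites (s : seq (nat * nat)) : seq nat := [seq site e.1 e.2 | e <- s].

Definition shift (s : nat) : seq nat -> seq nat := map (addn (6 * s)).

(** The six faces of the tube of ring 0, none of which is ever removed. In each
    table the faces come in pairs exchanged by the central symmetry. *)
Definition start_faces : seq (seq nat) := map sites
  [:: [:: (0, 4); (0, 5); (0, 0); (2, 3); (2, 4); (1, 2)];
      [:: (1, 5); (2, 1); (2, 0); (0, 3); (0, 2); (0, 1)];
      [:: (0, 0); (0, 1); (0, 2); (1, 4); (2, 2); (2, 3)];
      [:: (2, 0); (2, 5); (1, 1); (0, 5); (0, 4); (0, 3)];
      [:: (0, 2); (0, 3); (0, 4); (1, 2); (1, 3); (1, 4)];
      [:: (1, 1); (1, 0); (1, 5); (0, 1); (0, 0); (0, 5)]].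

(** The faces of the tube of ring 3 that survive the attachment of the tube of
    ring 4; those of later tubes are translates. *)
Definition tube_faces : seq (seq nat) := map sites
  [:: [:: (1, 3); (1, 2); (2, 4); (3, 2); (3, 1); (3, 0)];
      [:: (3, 3); (3, 4); (3, 5); (2, 1); (1, 5); (1, 0)];
      [:: (2, 2); (1, 4); (1, 3); (3, 0); (3, 5); (3, 4)];
      [:: (3, 1); (3, 2); (3, 3); (1, 0); (1, 1); (2, 5)]].

(** The two remaining faces of the last tube, to which one more tube could be
    attached, translated down to the rings 1 and 2. *)
Definition cap_faces : seq (seq nat) := map sites
  [:: [:: (1, 4); (1, 3); (1, 2); (2, 4); (2, 3); (2, 2)];
      [:: (2, 5); (2, 0); (2, 1); (1, 5); (1, 0); (1, 1)]].

Definition chain_order g : nat := 6 * (g + 3).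
Definition chain_size g : nat := 4 * g + 8.

(** The tube of ring [t + 3] owns the faces [4 * t + 6 + r] for [r < 4]; the two
    caps come last. In this numbering a translation by one ring adds 6 to the
    vertices and 4 to the faces. *)
Definition chain_face g f : seq nat :=
  if f < 6 then nth [::] start_faces f
  else if f < 4 * g + 6 then shift ((f - 6) %/ 4) (nth [::] tube_faces ((f - 6) %% 4))
  else shift g (nth [::] cap_faces (f - (4 * g + 6))).

Definition antipode v : nat := site (v %/ 6) ((v %% 6 + 3) %% 6).
Definition antiface f : nat := if odd f then f.-1 else f.+1.

Section LocalChecks.
Variables g v : nat.

Definition faces_at : seq nat := [seq f <- iota 0 (chain_size g) | v \in chain_face g f].

(** Pivoting around [v]: the face [e.2] is left through the edge by which its
    boundary enters [v]. *)
Definition turn (e : nat * nat) : nat * nat :=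
  let w := prev (chain_face g e.2) v in
  (w, nth 0 faces_at (find (fun f => next (chain_face g f) v == w) faces_at)).

Definition chain_fan : seq (nat * nat) :=
  let f := head 0 faces_at in
  traject turn (next (chain_face g f) v, f) (size faces_at).

Definition fan_ok : bool :=
  [&& uniq (map fst chain_fan), uniq (map snd chain_fan),
      all (fun f => (next (chain_face g f) v, f) \in chain_fan) faces_at,
      all (fun e => [&& e.2 \in faces_at, next (chain_face g e.2) v == e.1 &
                        prev (chain_face g e.2) v == (next chain_fan e).1]) chain_fan &
      (size chain_fan == 3) || (size chain_fan == 4)].

Definition meet_ok : bool :=
  all (fun f => all (fun h => (f != h) ==>
    let s := [seq u <- chain_face g f | u \in chain_face g h] in
    (size s <= 2) && all (fun u => (u != v) ==>
      (next (chain_face g f) u == v) || (next (chain_face g f) v == u)) s)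
    faces_at) faces_at.

(** Connectedness: a path to the vertex 0 descends through faces. *)
Definition descent_ok : bool :=
  (0 < v) ==> has (fun f => has (fun u => u < v) (chain_face g f)) faces_at.

Definition antipode_ok : bool :=
  all (fun f => (next (chain_face g f) v != antipode v) &&
                has (fun u => antipode u \notin chain_face g f) (chain_face g f))
      faces_at.

End LocalChecks.

Lemma small_chains_ok g v : 1 <= g <= 3 -> v < chain_order g ->
  [&& fan_ok g v, meet_ok g v, descent_ok g v & antipode_ok g v].
Proof.
have H : all (fun g => all (fun v =>
  [&& fan_ok g v, meet_ok g v, descent_ok g v & antipode_ok g v])
  (iota 0 (chain_order g))) (iota 1 3) by vm_compute.
move=> g13 lt_v; have gin : g \in iota 1 3 by rewrite mem_iota; lia.
by apply: (allP (allP H g gin) v); rewrite mem_iota.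
Qed.

Lemma start_faceP f : f < 6 ->
  let s := nth [::] start_faces f in [/\ uniq s, size s = 6 & all (fun x => x < 18) s].
Proof. by case: f => [|[|[|[|[|[|//]]]]]] _; split; vm_compute. Qed.

Lemma tube_faceP r : r < 4 ->
  let s := nth [::] tube_faces r in
  [/\ uniq s, size s = 6 & all (fun x => 6 <= x < 24) s].
Proof. by case: r => [|[|[|[|//]]]] _; split; vm_compute. Qed.

Lemma cap_faceP r : r < 2 ->
  let s := nth [::] cap_faces r in
  [/\ uniq s, size s = 6 & all (fun x => 6 <= x < 18) s].
Proof. by case: r => [|[|//]] _; split; vm_compute. Qed.

Lemma shiftD s t l : shift (s + t) l = shift s (shift t l).
Proof. by rewrite /shift -map_comp; apply: eq_map => x /=; lia. Qed.

Lemma shift0 l : shift 0 l = l.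
Proof. by rewrite /shift -[RHS]map_id; apply: eq_map. Qed.

Lemma shift_inj s : injective (addn (6 * s)).
Proof. by move=> x y; lia. Qed.

(** Case analysis on the three tables, in place of the nested conditionals. *)
Variant chain_face_spec g f : seq nat -> Prop :=
| StartFace of f < 6 : chain_face_spec g f (nth [::] start_faces f)
| TubeFace t r of t < g & r < 4 & f = 4 * t + 6 + r :
    chain_face_spec g f (shift t (nth [::] tube_faces r))
| CapFace r of r < 2 & f = 4 * g + 6 + r :
    chain_face_spec g f (shift g (nth [::] cap_faces r)).

Lemma chain_faceP g f : f < chain_size g -> chain_face_spec g f (chain_face g f).
Proof.
rewrite /chain_face /chain_size => lt_f; case: ifP => f6; first by constructor.
case: ifP => f4; first by apply: TubeFace; rewrite ?ltn_mod //; lia.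
by apply: CapFace; lia.
Qed.

Lemma chain_face_wf g f : f < chain_size g ->
  [/\ uniq (chain_face g f), size (chain_face g f) = 6 &
      all (fun x => x < chain_order g) (chain_face g f)].
Proof.
have sub (P Q : pred nat) s (l : seq nat) :
    (forall x, P x -> Q (6 * s + x)) -> all P l -> all Q (shift s l).
  by move=> PQ Pl; rewrite all_map; apply: sub_all Pl.
case/chain_faceP => [/start_faceP[u6 s6 a6]|t r lt_t /tube_faceP[u6 s6 a6] _|
                     r /cap_faceP[u6 s6 a6] _]; split.
- by [].
- by [].
- by apply: sub_all a6 => x; rewrite /chain_order; lia.
- by rewrite map_inj_uniq //; exact: shift_inj.
- by rewrite size_map.
- by apply: sub a6 => x; rewrite /chain_order; lia.
- by rewrite map_inj_uniq //; exact: shift_inj.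
- by rewrite size_map.
- by apply: sub a6 => x; rewrite /chain_order; lia.
Qed.

Lemma antipodeD s v : antipode (6 * s + v) = 6 * s + antipode v.
Proof. by rewrite /antipode /site; lia. Qed.

Lemma antipodeK : involutive antipode.
Proof. by move=> v; rewrite /antipode /site; lia. Qed.

Lemma antipode_neq v : antipode v != v.
Proof. by rewrite /antipode /site; lia. Qed.

Lemma antipode_lt n v : v < 6 * n -> antipode v < 6 * n.
Proof. by rewrite /antipode /site; lia. Qed.

Lemma antiface_lt g f : f < chain_size g -> antiface f < chain_size g.
Proof. by rewrite /chain_size /antiface; case: ifP; lia. Qed.

(** The tables are stable under the symmetry and it commutes with translations,
    so it preserves the whole chain. *)
Lemma chain_antiface g f : f < chain_size g ->
  chain_face g (antiface f) = map antipode (rev (chain_face g f)).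
Proof.
have shift_anti s l : shift s (map antipode l) = map antipode (shift s l).
  by rewrite /shift -!map_comp; apply: eq_map => x /=; rewrite antipodeD.
have shift_rev s l : shift s (rev l) = rev (shift s l) by rewrite /shift map_rev.
rewrite {1}/chain_face; case/chain_faceP => [f6|t r lt_t r4 ->|r r2 ->].
- have -> : antiface f < 6 by rewrite /antiface; case: ifP; lia.
  by move: f6; case: f => [|[|[|[|[|[|//]]]]]] _; vm_compute.
- have -> : antiface (4 * t + 6 + r) = 4 * t + 6 + antiface r.
    by rewrite /antiface; case: ifP; case: ifP; lia.
  have ar4 : antiface r < 4 by rewrite /antiface; case: ifP; lia.
  rewrite ifF; last lia. rewrite ifT; last lia.
  have -> : (4 * t + 6 + antiface r - 6) %/ 4 = t by lia.
  have -> : (4 * t + 6 + antiface r - 6) %% 4 = antiface r by lia.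
  rewrite -shift_rev -shift_anti; congr (shift t _).
  by move: r4 {ar4}; case: r => [|[|[|[|//]]]] _; vm_compute.
- have -> : antiface (4 * g + 6 + r) = 4 * g + 6 + antiface r.
    by rewrite /antiface; case: ifP; case: ifP; lia.
  have ar2 : antiface r < 2 by rewrite /antiface; case: ifP; lia.
  rewrite ifF; last lia. rewrite ifF; last lia.
  rewrite addKn -shift_rev -shift_anti; congr (shift g _).
  by move: r2 {ar2}; case: r => [|[|//]] _; vm_compute.
Qed.

(** The faces at [v] in the chain of genus [g] are the translates by [s] rings of
    the faces at [v'] in the chain of genus [g']. *)
Definition same_corner g v g' v' s : Prop :=
  [/\ 1 <= g' <= 3, v' < chain_order g', v = 6 * s + v', 0 < v -> 0 < v' &
      (forall f', f' < chain_size g' -> v' \in chain_face g' f' ->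
         4 * s + f' < chain_size g /\
         chain_face g (4 * s + f') = shift s (chain_face g' f')) /\
      (forall f, f < chain_size g -> v \in chain_face g f ->
         exists2 f', f' < chain_size g' & v' \in chain_face g' f' /\ f = 4 * s + f')].

(** For [g > 3] the model is the chain of genus 3: the vertex is moved down until
    it reaches ring 3, or until the far end of the chain of genus [g] has reached
    the far end of the chain of genus 3. On ring 3 neither end is seen, since
    start faces reach up to ring 2 only and the caps of genus 3 begin at
    ring 4. *)
Lemma corner_model g v : 1 <= g -> v < chain_order g ->
  exists g' v' s, same_corner g v g' v' s.
Proof.
move=> g1 lt_v; have [g3|g3] := leqP g 3.
  exists g, v, 0; split; rewrite ?muln0 ?add0n //; first by rewrite g1 g3.
  by split=> [f|f]; [rewrite shift0 | exists f].
pose s := minn (g - 3) (v %/ 6 - 3).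
have sv : 6 * s <= v by rewrite /s; lia.
have sg : s <= g - 3 by rewrite /s; lia.
have s0 : v < 18 -> s = 0 by rewrite /s; lia.
have s3 : 0 < s -> 6 * s + 18 <= v by rewrite /s; lia.
have s_max : 6 * s + 24 <= v -> s = g - 3 by rewrite /s; lia.
exists 3, (v - 6 * s), s.
have v'E : v = 6 * s + (v - 6 * s) by lia.
split=> //; first by move: lt_v s_max; rewrite /chain_order; lia.
  by move=> v0; have [|/s3] := posnP s; lia.
have in_shift t l : v \in shift t l -> exists2 x, x \in l & v = 6 * t + x.
  by case/mapP => x xl ->; exists x.
have in_shift' t l : v - 6 * s \in shift t l -> exists2 x, x \in l & v - 6 * s = 6 * t + x.
  by case/mapP => x xl ->; exists x.
split=> f lt_f.
  have lt_f3 : f < chain_size 3 by [].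
  have := lt_f; case/chain_faceP => [f6 vf|t r t3 r4 fE vf|r r2 fE vf].
  - have [_ _ /allP/(_ _ vf) v18] := start_faceP f6.
    have -> : s = 0.
      by have [//|/s3] := posnP s; lia.
    by rewrite muln0 shift0 /chain_face f6; split=> //; move: lt_f; rewrite /chain_size; lia.
  - have -> : 4 * s + f < chain_size g by rewrite /chain_size; lia.
    split=> //; rewrite /chain_face ifF; last lia.
    rewrite ifT; last lia.
    have -> : (4 * s + f - 6) %/ 4 = s + t by lia.
    have -> : (4 * s + f - 6) %% 4 = r by lia.
    by rewrite shiftD.
  - have [x xl vx] := in_shift' _ _ vf.
    have [_ _ /allP/(_ _ xl) x6] := cap_faceP r2.
    have sE : s = g - 3 by apply: s_max; lia.
    have -> : 4 * s + f < chain_size g by rewrite /chain_size; lia.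
    split=> //; rewrite /chain_face ifF; last lia.
    rewrite ifF; last lia.
    have -> : 4 * s + f - (4 * g + 6) = r by lia.
    by rewrite -shiftD; congr (shift _ _); lia.
case/chain_faceP: (lt_f) => [f6|t r tg r4 fE|r r2 fE] vf.
- have [_ _ /allP/(_ _ vf) v18] := start_faceP f6.
  have s00 : s = 0 by apply: s0.
  exists f; first by rewrite /chain_size; lia.
  by rewrite s00 muln0 subn0 /chain_face f6; split=> //; lia.
- have [x xl vx] := in_shift _ _ vf.
  have [_ _ /allP/(_ _ xl) x6] := tube_faceP r4.
  have st : s <= t by rewrite /s; lia.
  have t3 : t - s < 3 by rewrite /s; lia.
  exists (f - 4 * s); first by rewrite /chain_size; lia.
  split; last lia.
  rewrite /chain_face ifF; last lia.
  rewrite ifT; last lia.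
  have -> : (f - 4 * s - 6) %/ 4 = t - s by lia.
  have -> : (f - 4 * s - 6) %% 4 = r by lia.
  by apply/mapP; exists x => //; lia.
- have [x xl vx] := in_shift _ _ vf.
  have [_ _ /allP/(_ _ xl) x6] := cap_faceP r2.
  have sE : s = g - 3 by rewrite /s; lia.
  exists (f - 4 * s); first by rewrite /chain_size; lia.
  split; last lia.
  rewrite /chain_face ifF; last lia.
  rewrite ifF; last lia.
  have -> : f - 4 * s - (4 * 3 + 6) = r by lia.
  by apply/mapP; exists x => //; lia.
Qed.

Section Chain.
Variable g : nat.
Hypothesis g1 : 1 <= g.
Local Notation V := 'I_(chain_order g).
Local Notation Fc := 'I_(chain_size g).

Lemma lift_ordinals m (l : seq nat) : all (fun x => x < m) l ->
  map val (pmap (insub : nat -> option 'I_m) l) = l.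
Proof.
by elim: l => //= x l IH /andP[xm /IH{}IH]; rewrite insubT /= IH.
Qed.

Lemma lift_ordinal_pairs m n (l : seq (nat * nat)) :
  all (fun e => (e.1 < m) && (e.2 < n)) l ->
  exists l' : seq ('I_m * 'I_n), map (fun e => (val e.1, val e.2)) l' = l.
Proof.
elim: l => [|[x y] l IH] /=; first by exists [::].
by case/andP=> /andP[xm yn] /IH[l' <-]; exists ((Ordinal xm, Ordinal yn) :: l').
Qed.

Definition chain_bd (f : Fc) : seq V := pmap insub (chain_face g f).

Lemma val_chain_bd f : map val (chain_bd f) = chain_face g f.
Proof. by apply: lift_ordinals; have [] := chain_face_wf (ltn_ord f). Qed.

Lemma mem_chain_bd f (v : V) : (v \in chain_bd f) = (val v \in chain_face g f).
Proof. by rewrite -val_chain_bd (mem_map val_inj). Qed.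

Lemma uniq_chain_bd f : uniq (chain_bd f).
Proof.
rewrite -(map_inj_uniq val_inj) val_chain_bd.
by have [] := chain_face_wf (ltn_ord f).
Qed.

Lemma val_next_chain_bd f (v : V) :
  val (next (chain_bd f) v) = next (chain_face g f) (val v).
Proof. by rewrite -val_chain_bd next_map ?uniq_chain_bd //; exact: val_inj. Qed.

Lemma val_prev_chain_bd f (v : V) :
  val (prev (chain_bd f) v) = prev (chain_face g f) (val v).
Proof. by rewrite -val_chain_bd prev_map ?uniq_chain_bd //; exact: val_inj. Qed.

Lemma chain_corner (v : V) : exists g' v' s,
  [/\ same_corner g v g' v' s, fan_ok g' v', meet_ok g' v', descent_ok g' v' &
      antipode_ok g' v'].
Proof.
have [g' [v' [s c]]] := corner_model g1 (ltn_ord v); exists g', v', s.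
have [g'13 lt_v' _ _ _] := c.
by have /and4P[] := small_chains_ok g'13 lt_v'.
Qed.

Lemma mem_faces_at g' v' f' :
  (f' \in faces_at g' v') = (f' < chain_size g') && (v' \in chain_face g' f').
Proof. by rewrite mem_filter mem_iota add0n andbC. Qed.

Lemma corner_face (v : V) g' v' s (f : Fc) : same_corner g v g' v' s ->
  v \in chain_bd f -> exists2 f', f' \in faces_at g' v' &
    val f = 4 * s + f' /\ chain_face g f = shift s (chain_face g' f').
Proof.
case=> _ _ _ _ [c1 c2]; rewrite mem_chain_bd => vf.
have [f' lt_f' [vf' fE]] := c2 f (ltn_ord f) vf.
exists f'; first by rewrite mem_faces_at lt_f'.
by split=> //; rewrite fE; have [] := c1 f' lt_f' vf'.
Qed.

Lemma next_shift g' s f' x : f' < chain_size g' ->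
  next (shift s (chain_face g' f')) (6 * s + x) = 6 * s + next (chain_face g' f') x.
Proof.
by move=> /chain_face_wf[u _ _]; rewrite next_map //; exact: shift_inj.
Qed.

Lemma prev_shift g' s f' x : f' < chain_size g' ->
  prev (shift s (chain_face g' f')) (6 * s + x) = 6 * s + prev (chain_face g' f') x.
Proof.
by move=> /chain_face_wf[u _ _]; rewrite prev_map //; exact: shift_inj.
Qed.

Lemma mem_shift s x l : (6 * s + x \in shift s l) = (x \in l).
Proof. by rewrite mem_map //; exact: shift_inj. Qed.

(** The fan of the model vertex is translated, then read in the ordinals; both
    maps are injective, so they commute with [next] and [prev]. *)
Lemma chain_vertex_fan (v : V) : exists l,
  vertex_fan chain_bd v l /\ (size l = 3 \/ size l = 4).
Proof.
have [g' [v' [s [c ok _ _ _]]]] := chain_corner v.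
have [g'13 lt_v' vE _ [c1 c2]] := c; have {}vE : val v = 6 * s + v' := vE.
case/and5P: ok; set l' := chain_fan g' v'.
move=> u1 u2 /allP l1 /allP l2 l34.
pose val2 (e : V * Fc) := (val e.1, val e.2).
pose tr (e : nat * nat) := (6 * s + e.1, 4 * s + e.2).
have val2_inj : injective val2 by move=> [a b] [a' b'] [/val_inj -> /val_inj ->].
have tr_inj : injective tr by move=> [a b] [a' b'] [*]; congr (_, _); lia.
have face_at e : e \in l' -> [/\ e.2 < chain_size g', v' \in chain_face g' e.2,
    next (chain_face g' e.2) v' = e.1 & prev (chain_face g' e.2) v' = (next l' e).1].
  by move=> /l2 /and3P[]; rewrite mem_faces_at => /andP[-> ->] /eqP -> /eqP ->.
have [l lE] : exists l, map val2 l = map tr l'.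
  apply: lift_ordinal_pairs; rewrite all_map; apply/allP => e /= /face_at[lt_e v'e ne _].
  have [-> ce] := c1 _ lt_e v'e; rewrite andbT.
  have [_ _ /allP] := chain_face_wf (c1 _ lt_e v'e).1; apply.
  by rewrite ce mem_shift -ne mem_next.
have l_uniq : uniq l.
  by rewrite -(map_inj_uniq val2_inj) lE map_inj_uniq // (map_uniq u1).
exists l; split; last first.
  have -> : size l = size l' by rewrite -(size_map val2) lE size_map.
  by case/orP: l34 => /eqP ->; [left | right].
split.
- rewrite -(map_inj_uniq val_inj).
  have -> : map val (map fst l) = map fst (map val2 l) by rewrite -!map_comp.
  rewrite lE -map_comp (map_comp (addn (6 * s)) fst) map_inj_uniq //.
  exact: shift_inj.
- rewrite -(map_inj_uniq val_inj).
  have -> : map val (map snd l) = map snd (map val2 l) by rewrite -!map_comp.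
  by rewrite lE -map_comp (map_comp (addn (4 * s)) snd) map_inj_uniq //; exact: addnI.
- move=> f vf; have [f' f'at [fE cfE]] := corner_face c vf.
  rewrite -(mem_map val2_inj) lE.
  have -> : val2 (next (chain_bd f) v, f) = tr (next (chain_face g' f') v', f').
    have lt_f' : f' < chain_size g' by move: f'at; rewrite mem_faces_at => /andP[].
    by rewrite /val2 /tr /= val_next_chain_bd cfE fE vE next_shift.
  by rewrite (mem_map tr_inj); exact: l1.
- move=> e el; have : val2 e \in map tr l' by rewrite -lE map_f.
  case/mapP => e' e'l ee'; have [lt_e v'e ne pe] := face_at _ e'l.
  have [_ ce] := c1 _ lt_e v'e.
  have [e1E e2E] : val e.1 = 6 * s + e'.1 /\ val e.2 = 4 * s + e'.2 by case: ee'.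
  split.
  + by rewrite mem_chain_bd e2E ce vE mem_shift.
  + by apply: val_inj; rewrite val_next_chain_bd e2E ce vE next_shift // ne e1E.
  + apply: val_inj; rewrite val_prev_chain_bd e2E ce vE prev_shift // pe.
    have -> : val (next l e).1 = (val2 (next l e)).1 by [].
    rewrite -(next_map val2_inj) // lE ee' next_map //.
    exact: map_uniq u1.
Qed.

Lemma chain_meet f h (v : V) : f != h -> v \in chain_bd f -> v \in chain_bd h ->
  size [seq u <- chain_bd f | u \in chain_bd h] <= 2 /\
  forall u, u != v -> u \in chain_bd f -> u \in chain_bd h ->
    next (chain_bd f) u = v \/ next (chain_bd f) v = u.
Proof.
move=> fh vf vh; have [g' [v' [s [c _ ok _ _]]]] := chain_corner v.
have [_ _ vE _ _] := c; have {}vE : val v = 6 * s + v' := vE.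
have [f' f'at [fE cfE]] := corner_face c vf.
have [h' h'at [hE chE]] := corner_face c vh.
have lt_f' : f' < chain_size g' by move: f'at; rewrite mem_faces_at => /andP[].
have f'h' : f' != h'.
  by apply: contraNneq fh => e; rewrite -val_eqE /= fE hE e.
have /andP[le2 /allP nbr] := implyP (allP (allP ok _ f'at) _ h'at) f'h'.
have inter : map val [seq u <- chain_bd f | u \in chain_bd h] =
    shift s [seq u <- chain_face g' f' | u \in chain_face g' h'].
  transitivity [seq u <- chain_face g f | u \in chain_face g h].
    rewrite -(val_chain_bd f) filter_map; congr map; apply: eq_filter => u /=.
    by rewrite mem_chain_bd.
  rewrite cfE chE filter_map; congr map; apply: eq_filter => u /=.
  by rewrite mem_shift.
split; first by rewrite -(size_map val) inter size_map.
move=> u uv uf uh; have : val u \in map val [seq u <- chain_bd f | u \in chain_bd h].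
  by rewrite map_f // mem_filter uh.
rewrite inter => /mapP[u' u'f uE].
have u'v' : u' != v' by apply: contraNneq uv => e; rewrite -val_eqE /= uE vE e.
have := implyP (nbr u' u'f) u'v'.
rewrite -(inj_eq (@shift_inj s)) -(inj_eq (@shift_inj s) (next _ v')).
rewrite -!(next_shift s _ lt_f') -cfE -uE -vE -!val_next_chain_bd !val_eqE.
by case/orP => /eqP; [left | right].
Qed.

Lemma chain_order_gt0 : 0 < chain_order g.
Proof. by rewrite /chain_order; lia. Qed.

Definition chain_origin : V := Ordinal chain_order_gt0.

Lemma chain_connected (v : V) : connect (share_face chain_bd) chain_origin v.
Proof.
have [n] := ubnP (val v); elim: n v => // n IH v; rewrite ltnS => le_vn.
have [v0|v_gt0] := posnP (val v).
  by have -> : v = chain_origin by exact: val_inj.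
have [g' [v' [s [c _ _ ok _]]]] := chain_corner v.
have [_ _ vE /(_ v_gt0) v'_gt0 [c1 _]] := c.
have {}vE : val v = 6 * s + v' := vE.
have /hasP[f'] := implyP ok v'_gt0; rewrite mem_faces_at => /andP[lt_f' v'f'].
case/hasP => u' u'f' lt_u'v'; have [lt_f cfE] := c1 f' lt_f' v'f'.
have uf : 6 * s + u' \in chain_face g (4 * s + f') by rewrite cfE mem_shift.
have lt_u : 6 * s + u' < chain_order g.
  by have [_ _ /allP/(_ _ uf)] := chain_face_wf lt_f.
apply: connect_trans (IH (Ordinal lt_u) _) (connect1 _); first by rewrite /=; lia.
apply/existsP; exists (Ordinal lt_f); rewrite !mem_chain_bd /= uf vE cfE.
by rewrite mem_shift.
Qed.

Lemma chain_scheme : hexagonal_scheme chain_bd.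
Proof.
split.
- exact: uniq_chain_bd.
- move=> f; rewrite -(size_map val) val_chain_bd.
  by have [] := chain_face_wf (ltn_ord f).
- exact: chain_vertex_fan.
- move=> f h fh; case E : [seq _ <- _ | _] => [//|v l]; rewrite -E.
  have : v \in [seq v <- chain_bd f | v \in chain_bd h] by rewrite E mem_head.
  by rewrite mem_filter => /andP[vh vf]; have [] := chain_meet fh vf vh.
- by move=> f h u v fh uv uf vf uh vh; have [_] := chain_meet fh vf vh; apply.
- by exists chain_origin; exact: chain_connected.
Qed.

Definition antipode_ord (v : V) : V := Ordinal (antipode_lt (ltn_ord v)).
Definition antiface_ord (f : Fc) : Fc := Ordinal (antiface_lt (ltn_ord f)).

Lemma chain_reversing_symmetry :
  reversing_symmetry chain_bd antipode_ord antiface_ord.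
Proof.
have anti_inj : injective antipode := inv_inj antipodeK.
have check (v : V) f : v \in chain_bd f ->
    next (chain_bd f) v != antipode_ord v /\
    exists2 u, u \in chain_bd f & antipode_ord u \notin chain_bd f.
  move=> vf; have [g' [v' [s [c _ _ _ ok]]]] := chain_corner v.
  have [_ _ vE _ _] := c; have {}vE : val v = 6 * s + v' := vE.
  have [f' f'at [fE cfE]] := corner_face c vf.
  have lt_f' : f' < chain_size g' by move: f'at; rewrite mem_faces_at => /andP[].
  have /andP[ne /hasP[u' u'f' au']] := allP ok _ f'at; split.
    rewrite -val_eqE val_next_chain_bd /= cfE vE next_shift // antipodeD.
    by rewrite (inj_eq (@shift_inj s)).
  have : 6 * s + u' \in map val (chain_bd f) by rewrite val_chain_bd cfE mem_shift.
  case/mapP => u uf uE; exists u => //.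
  by rewrite mem_chain_bd /= -uE antipodeD cfE mem_shift.
split.
- by move=> v; apply: val_inj; rewrite /= antipodeK.
- move=> f v vf; have [u_f _ _] := chain_face_wf (ltn_ord f).
  have cE := chain_antiface (ltn_ord f); split.
    by rewrite mem_chain_bd /= cE (mem_map anti_inj) mem_rev -mem_chain_bd.
  apply: val_inj; rewrite val_next_chain_bd /= cE next_map ?rev_uniq //.
  by rewrite next_rev // val_next_chain_bd prev_next.
- by move=> v; rewrite -val_eqE /= antipode_neq.
- by move=> f v /check[].
- move=> f; have : 0 < size (chain_bd f) by rewrite (hex_size chain_scheme).
  case E : (chain_bd f) => [//|v l] _.
  by have /check[_] : v \in chain_bd f; rewrite E ?mem_head.
Qed.

End Chain.

End HexagonalChains.

(** The Euler characteristic is [V - 2 * F = 6 * (g + 3) - 2 * (4 * g + 8)], that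
    is [2 - 2 * g]. *)
Theorem centrally_symmetric_hexagonal_maps (R : realType) (g : nat) : (1 <= g)%N ->
  exists (S : topologicalType) (M : drawing R S),
    orientable_surface_of_genus R S g /\ surface_map M /\
    centrally_symmetric M /\ #|vertex M| = (6 * (g + 3))%N /\
    (forall F : set S, faces M F -> hexagon M F).
Proof.
move=> g1; have H := chain_scheme g1.
exists (polyhedron R (cone_complex (@chain_bd g))), (hex_drawing H R).
split; [split; first exact: cone_polyhedron_surface | split; last split; last split].
- exists (hex_drawing H R); split.
  + exact: hex_surface_map.
  + exact: hex_coherently_orientable.
  + have := hex_euler_characteristic H R; rewrite !card_ord.
    by rewrite /chain_order /chain_size; congr euler_characteristic; lia.
- exact: hex_surface_map.
- exact: hex_centrally_symmetric (chain_reversing_symmetry g1).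
- by rewrite /= card_ord.
- exact: hex_hexagon.
Qed.

Theorem theorem1p4 (R : realType) (k : nat) (hk : (1 <= k)%N) :
  exists (S : topologicalType) (M : drawing R S),
    orientable_surface_of_genus R S (2 * k - 1)%N /\
    surface_map M /\
    centrally_symmetric M /\
    #|vertex M| = (24 + 12 * ((2 * k - 1) %/ 2))%N /\
    (forall F : set S, faces M F -> hexagon M F).
Proof.
have g1 : (1 <= 2 * k - 1)%N by lia.
have [S [M [HS [HM [HC [HV HF]]]]]] := centrally_symmetric_hexagonal_maps R g1.
by exists S, M; do 4![split=> //]; rewrite HV; lia.
Qed.
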